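(* For every $\alpha\in(0,1)$ one has $$\|\mathcal T^b_\varepsilon(\phi)\|_{L^2(\Omega;H^{-\alpha}(S))}=\varepsilon^{1/2}\|\phi\|_{H^{-\alpha}(S_\varepsilon)}\qquad\forall\phi\in H^{-\alpha}(S_\varepsilon),$$ $$\|\mathcal T^b_\varepsilon(\phi)\|_{L^2(\Omega;\widetilde H^{-\alpha}(S))}=\varepsilon^{1/2}\|\phi\|_{\widetilde H^{-\alpha}(S_\varepsilon)}\qquad\forall\phi\in\widetilde H^{-\alpha}(S_\varepsilon).$$
   Context: $\Omega\subset\mathbb R^3$ is a bounded domain with Lipschitz boundary, $\mathbf Y=(0,1)^3$. $\mathcal S$ is a domain strictly included in $\mathbf Y$ with $C^{1,1}$ boundary; $S$ is the closure of an open connected subset of $\partial\mathcal S$. For a.e. $z\in\mathbb R^3$, $z=[z]+\{z\}$ with $[z]\in\mathbb Z^3$, $\{z\}\in\mathbf Y$. For $\varepsilon>0$: $\Xi_\varepsilon=\{\xi\in\mathbb Z^3:\varepsilon\xi+\varepsilon\mathbf Y\subset\Omega\}$, $\widehat\Omega_\varepsilon=\mathrm{interior}\bigcup_{\xi\in\Xi_\varepsilon}(\varepsilon\xi+\varepsilon\overline{\mathbf Y})$, $\Lambda_\varepsilon=\Omega\setminus\overline{\widehat\Omega_\varepsilon}$, $S_\varepsilon=\{x\in\widehat\Omega_\varepsilon:\{x/\varepsilon\}\in S\}$, and $\mathcal S_\varepsilon=\{x\in\widehat\Omega_\varepsilon:\{x/\varepsilon\}\in\mathcal S\}$. Norms: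 $\|v\|^2_{H^\alpha(S)}=\|v\|^2_{L^2(S)}+\int_S\int_S\frac{|v(x)-v(y)|^2}{|x-y|^{2+2\alpha}}d\sigma_xd\sigma_y$; $\|v\|^2_{H^\alpha(S_\varepsilon)}=\|v\|^2_{L^2(S_\varepsilon)}+\varepsilon^{2\alpha}\sum_{\xi\in\Xi_\varepsilon}\int_{\varepsilon\xi+\varepsilon S}\int_{\varepsilon\xi+\varepsilon S}\frac{|v(x)-v(y)|^2}{|x-y|^{2+2\alpha}}d\sigma_xd\sigma_y$. $\widetilde H^\alpha(S)$ is the space of $v\in H^\alpha(S)$ whose extension by $0$ to $\partial\mathcal S\setminus S$ belongs to $H^\alpha(\partial\mathcal S)$, and $\widetilde H^\alpha(S_\varepsilon)$ is defined likewise (cell by cell, with $\partial\mathcal S_\varepsilon$); they are normed by the $H^\alpha(\partial\mathcal S)$, resp. $H^\alpha(\partial\mathcal S_\varepsilon)$, norm of the zero extension (the latter defined by the same formula as for $S_\varepsilon$ with $S$ replaced by $\partial\mathcal S$). $H^{-\alpha}(S_\varepsilon)$, $\widetilde H^{-\alpha}(S_\varepsilon)$, $H^{-\alpha}(S)$, $\widetilde H^{-\alpha}(S)$ are the duals of $H^\alpha(S_\varepsilon)$, $\widetilde H^\alpha(S_\varepsilon)$, $H^\alpha(S)$, $\widetilde H^\alpha(S)$ with the dual norms. Averaging operator: for $\Phi\in L^p(\Omega\times S)$, $\mathcal U^b_\varepsilon(\Phi)(x)=\int_{\mathbf Y}\Phi\big(\varepsilon[x/\varepsilon]+\varepsilon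 z,\{x/\varepsilon\}\big)dz$ for a.e. $x\in S_\varepsilon$ (note $S_\varepsilon\subset\widehat\Omega_\varepsilon$). Unfolding on negative-order spaces, by duality: for $g\in H^{-\alpha}(S_\varepsilon)$, $\mathcal T^b_\varepsilon(g)\in L^2(\Omega;H^{-\alpha}(S))$ (the dual of $L^2(\Omega;H^\alpha(S))$) is defined by $$\langle\mathcal T^b_\varepsilon(g),\Phi\rangle=\varepsilon\,\langle g,\mathcal U^b_\varepsilon(\Phi)\rangle_{H^{-\alpha}(S_\varepsilon),H^\alpha(S_\varepsilon)}\qquad\forall\Phi\in L^2(\Omega;H^\alpha(S)),$$ and for $g\in\widetilde H^{-\alpha}(S_\varepsilon)$, $\mathcal T^b_\varepsilon(g)\in L^2(\Omega;\widetilde H^{-\alpha}(S))$ is defined in the same way with $\widetilde H^\alpha$ in place of $H^\alpha$. *)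

(* Defs.v *)
From HB Require Import structures.
From mathcomp Require Import all_boot all_order all_algebra.
From mathcomp Require Import all_classical all_reals all_analysis.

Set Implicit Arguments.
Unset Strict Implicit.
Unset Printing Implicit Defensive.
Import Order.TTheory GRing.Theory Num.Theory.
Import numFieldNormedType.Exports.

Local Open Scope classical_set_scope.
Local Open Scope ring_scope.

(* The library norm on products is the sup norm; it induces the topology, but
   distances are measured with the Euclidean norm [enorm]. [measurableTypeR R]
   is R itself, with the Borel structure on which [lebesgue_measure] lives. *)
Notation pt R :=
  (measurableTypeR R * measurableTypeR R * measurableTypeR R)%type.

Definition enorm (R : realType) (x : pt R) : R :=
  Num.sqrt (x.1.1 ^+ 2 + x.1.2 ^+ 2 + x.2 ^+ 2).

Definition leb3 (R : realType) : {measure set (pt R) -> \bar R} :=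
  ((@lebesgue_measure R \x @lebesgue_measure R) \x @lebesgue_measure R)%E.

Definition bd (T : topologicalType) (A : set T) : set T :=
  closure A `\` interior A.

Section surface_measure.
Context (R : realType).
Local Open Scope ereal_scope.

Definition ediam (A : set (pt R)) : \bar R :=
  ereal_sup (0 |` [set (enorm (p.1 - p.2)%R)%:E | p in A `*` A]).

(* Two-dimensional Hausdorff (outer) measure. The factor pi / 4 is the area of
   a disc of diameter 1, so that on C^1 surfaces this is the area. It is
   countably additive on Borel sets, the only sets that the integrals below
   evaluate it on. *)
Definition surf (A : set (pt R)) : \bar R :=
  ereal_sup [set ereal_inf
      [set \sum_(0 <= i <oo) (pi / 4)%:E * ediam (U i) ^+ 2
        | U in [set U : nat -> set (pt R) |
                A `<=` \bigcup_i U i /\ forall i, ediam (U i) <= d%:E]]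
    | d in [set d : R | (0 < d)%R]].

End surface_measure.

Section domains.
Context (R : realType).

Definition is_domain (A : set (pt R)) := [/\ A !=set0, open A & connected A].

Definition isometry (rho : pt R -> pt R) :=
  forall x y, enorm (rho x - rho y) = enorm (x - y).

(* Near every boundary point, A is, up to a rigid motion, the part of space
   strictly above the graph of a function of class [reg]. *)
Definition boundary_of_class (reg : (R * R -> R) -> Prop) (A : set (pt R)) :=
  forall p, bd A p -> exists rho (gamma : R * R -> R) (r : R),
    [/\ isometry rho, reg gamma, 0 < r &
        forall x, enorm (x - p) < r -> (A x <-> gamma (rho x).1 < (rho x).2)].

Definition lipschitz_boundary :=
  boundary_of_class (fun gamma => lipschitz gamma).

Definition C11 (gamma : R * R -> R) :=
  (forall x, differentiable gamma x) /\
  exists L : R, forall x y v : R * R,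
    `|'d gamma x v - 'd gamma y v| <= L * `|x - y| * `|v|.

Definition C11_boundary := boundary_of_class C11.

End domains.

Section cells.
Context (R : realType).

Definition unit_cube : set (pt R) :=
  [set x | [/\ 0 < x.1.1 < 1, 0 < x.1.2 < 1 & 0 < x.2 < 1]].

Definition zvec (xi : int * int * int) : pt R :=
  (xi.1.1%:~R, xi.1.2%:~R, xi.2%:~R).

Definition ipart (x : pt R) : pt R :=
  zvec (Num.floor x.1.1, Num.floor x.1.2, Num.floor x.2).

(* [fpart x] lies in the half-open unit cube, and in [unit_cube] exactly when no
   coordinate of x is an integer. *)
Definition fpart (x : pt R) : pt R := x - ipart x.

Definition cell (eps : R) (xi : int * int * int) (G : set (pt R)) :
  set (pt R) := [set eps *: zvec xi + eps *: y | y in G].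

Definition Xi (Om : set (pt R)) (eps : R) : set (int * int * int) :=
  [set xi | cell eps xi unit_cube `<=` Om].

Definition Omhat (Om : set (pt R)) (eps : R) : set (pt R) :=
  interior (\bigcup_(xi in Xi Om eps) cell eps xi (closure unit_cube)).

Definition cell_union (Om : set (pt R)) (eps : R) (G : set (pt R)) :
  set (pt R) := [set x | Omhat Om eps x /\ G (fpart (eps^-1 *: x))].

End cells.

(* A space of functions with a seminorm: functions are not identified when they
   agree almost everywhere. A bounded linear functional vanishes on functions
   of seminorm 0, so the dual is that of the quotient normed space. *)
Record seminormed (R : realType) (F : Type) := Seminormed {
  carrier :> F -> Prop;
  seminorm : F -> \bar R }.

Section duality.
Context (R : realType) (F : lmodType R) (V : seminormed R F).

Definition dual_space : set (F -> R) := [set g |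
  (forall a u v, V u -> V v -> g (a *: u + v) = a * g u + g v) /\
  exists C : R, forall v, V v -> (`|g v|%:E <= C%:E * seminorm V v)%E].

Definition dual_norm (g : F -> R) : \bar R :=
  ereal_sup [set `|g v|%:E | v in [set v | V v /\ (seminorm V v <= 1)%E]].

End duality.

Section fractional_spaces.
Context (R : realType) (al : R).
Implicit Types (G Om Sc S : set (pt R)) (v : pt R -> R).
Local Open Scope ereal_scope.

Definition L2sq G v : \bar R := \int[@surf R]_(x in G) ((v x) ^+ 2)%:E.

Definition gagliardo G v : \bar R :=
  \int[@surf R]_(x in G) \int[@surf R]_(y in G)
    ((v x - v y) ^+ 2 / enorm (x - y) `^ (2 + 2 * al))%:E.

Definition H_norm G v : \bar R := (L2sq G v + gagliardo G v) `^ 2^-1.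

Definition H_space G : seminormed R (pt R -> R) :=
  Seminormed [set v | measurable_fun G v /\ H_norm G v < +oo] (H_norm G).

Definition Heps_norm Om (eps : R) G v : \bar R :=
  (L2sq (cell_union Om eps G) v +
   (eps `^ (2 * al))%:E * \esum_(xi in Xi Om eps) gagliardo (cell eps xi G) v)
  `^ 2^-1.

Definition Heps_space Om (eps : R) G : seminormed R (pt R -> R) :=
  Seminormed
    [set v | measurable_fun (cell_union Om eps G) v /\
             Heps_norm Om eps G v < +oo]
    (Heps_norm Om eps G).

(* [v \_ S] is v on S and 0 elsewhere. *)
Definition Htilde_space Sc S : seminormed R (pt R -> R) :=
  Seminormed
    [set v | H_space S v /\ H_space (bd Sc) (v \_ S)]
    (fun v => H_norm (bd Sc) (v \_ S)).

Definition Htilde_eps_space Om (eps : R) Sc S : seminormed R (pt R -> R) :=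
  Seminormed
    [set v | Heps_space Om eps S v /\
             Heps_space Om eps (bd Sc) (v \_ (cell_union Om eps S))]
    (fun v => Heps_norm Om eps (bd Sc) (v \_ (cell_union Om eps S))).

End fractional_spaces.

Section bochner.
Context (R : realType).
Implicit Types (Om S : set (pt R)) (V : seminormed R (pt R -> R)).
Implicit Types (Phi s : pt R -> pt R -> R).

Definition simple_valued V s :=
  exists (n : nat) (A : 'I_n -> set (pt R)) (v : 'I_n -> pt R -> R),
    [/\ forall i, measurable (A i), forall i, V (v i) &
        forall x y, s x y = \sum_(i < n) \1_(A i) x * v i y].

Definition strongly_measurable Om V Phi :=
  exists s : nat -> pt R -> pt R -> R, (forall n, simple_valued V (s n)) /\
    {ae @leb3 R, forall x, Om x ->
      seminorm V (fun y => s n x y - Phi x y) @[n --> \oo] --> 0%E}.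

Definition bochner_norm Om V Phi : \bar R :=
  ((\int[@leb3 R]_(x in Om) (seminorm V (Phi x)) ^+ 2) `^ 2^-1)%E.

(* L^2(Om; V) for a space V of functions on S. Every Bochner class has a
   representative which is jointly measurable on Om x S; such representatives
   are required because averaging in x evaluates [Phi x y] at fixed y. *)
Definition L2_bochner Om S V : seminormed R (pt R -> pt R -> R) :=
  Seminormed
    [set Phi | [/\ measurable_fun (Om `*` S)
                     (fun p : pt R * pt R => Phi p.1 p.2),
                   {ae @leb3 R, forall x, Om x -> V (Phi x)},
                   strongly_measurable Om V Phi &
                   (bochner_norm Om V Phi < +oo)%E]]
    (bochner_norm Om V).

End bochner.

Section unfolding.
Context (R : realType) (eps : R).

Definition Ub (Phi : pt R -> pt R -> R) (x : pt R) : R :=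
  \int[@leb3 R]_(z in @unit_cube R)
    Phi (eps *: ipart (eps^-1 *: x) + eps *: z) (fpart (eps^-1 *: x)).

Definition Tb (g : (pt R -> R) -> R) (Phi : pt R -> pt R -> R) : R :=
  eps * g (Ub Phi).

End unfolding.

(* Main.v *)
Require Import Defs.
From HB Require Import structures.
From mathcomp Require Import all_boot all_order all_algebra.
From mathcomp Require Import all_classical all_reals all_analysis.
From mathcomp Require Import measurable_realfun.
From mathcomp Require Import ring lra zify.
Import Order.TTheory GRing.Theory Num.Theory.
Import numFieldNormedType.Exports.
Set Implicit Arguments.
Unset Strict Implicit.
Unset Printing Implicit Defensive.
Local Open Scope classical_set_scope.
Local Open Scope ring_scope.

(** The functional [Tb eps phi] is [eps * phi] composed with the averaging operator
    [Ub eps], so its norm is governed by how [Ub] maps the unit ball of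
    [L^2(Om; V)] to functions on [S_eps]. Two facts give the identity:
    - [sqrt eps * ||Ub Phi|| <= ||Phi||] for every [Phi] ([sqrt_eps_norm_Ub]);
    - every [u] is [Ub Phi] on [S_eps] for some [Phi] with
      [||Phi|| = sqrt eps * ||u||] ([Ub_cell_const], [bochner_cell_const]).

    Both rest on scaling. Let [tau xi y = eps xi + eps y] be the parametrization of
    the cell [xi], and let [E] be the square of the norm on the fixed surface,
    called [energy] below. The map [tau xi] multiplies area by [eps^2], and the
    weight [eps^(2 al)] in front of the double integral compensates for the
    homogeneity of its kernel, whence [||u||^2 = eps^2 * sum_xi E (u o tau xi)]
    ([Heps_normE], [ext_eps_normE]).

    For the first fact, [(Ub Phi) o tau xi] is the mean over [z] in the unit cube
    of the functions [Phi (tau xi z)] ([Ub_slice]). Since [E] integrates squares of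
    linear expressions, the inequality of Jensen and the theorem of Tonelli show
    that [E] of a mean is at most the mean of [E] ([energy_average_le]). The change
    of variables [x = tau xi z] has Jacobian [eps^3], so summing over the cells
    bounds [eps * ||Ub Phi||^2] by the integral of [E (Phi x)] over [Om]. For the
    second fact, take [Phi x = u o tau xi] for [x] in the cell [xi] and [Phi x = 0]
    outside the cells: the mean is over equal functions, and every inequality
    above is an equality.

    The space of functions on [S] normed through their extension by 0 to a surface
    [G] is [H^al(S)] for [G = S] and the tilde space for [G = bd Sc]
    ([ext_space], [ext_eps_space]), so one argument covers both identities. A slice
    [z |-> Phi (tau xi z) y] is integrable for almost every [y] only, and [Ub] is
    linear only up to negligible sets; functionals do not see these
    ([dual_ae_eq]).

    The theorem of Tonelli on surfaces requires Hausdorff measure to be a measure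
    on Borel sets and the surfaces to have finite area. The former is the criterion
    of Caratheodory for metric outer measures ([caratheodory_sublevel],
    [measurable_surf_caratheodory]). For the latter ([surf_boundary_lty]), the
    boundary of class C^{1,1} is compact and is locally a Lipschitz graph over a
    square; cutting the square into [N^2] squares yields pieces of the graph of
    diameter [O (1 / N)] ([surf_graph_lty]). *)

(** * Sublevel sets for outer measures additive on separated sets *)

(** [mu_sep] is additivity on sets that [f] separates by a positive gap. It
    suffices for Caratheodory's criterion, where no gap is available: this is
    the classical argument for metric outer measures, with the values of a
    single function in place of distances. *)
Section separated_outer_measure.
Local Open Scope ereal_scope.
Context (R : realType) (T : Type) (mu : {outer_measure set T -> \bar R}).
Variable f : T -> R.
Hypothesis mu_sep : forall (A B : set T) (r s : R), (r < s)%R ->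
  A `<=` [set x | (f x <= r)%R] -> B `<=` [set x | (s <= f x)%R] ->
  mu A + mu B <= mu (A `|` B).

Lemma sum_separated_le (X : set T) (A : nat -> set T) (l u : nat -> R) :
  (forall i, A i `<=` X) ->
  (forall i, A i `<=` [set x | (l i <= f x)%R /\ (f x <= u i)%R]) ->
  (forall i j, (i < j)%N -> (u j < l i)%R) ->
  forall n, \sum_(i < n) mu (A i) <= mu X.
Proof.
move=> AX Alu ul n.
suff h : \sum_(i < n) mu (A i) <= mu (\big[setU/set0]_(i < n) A i).
  apply: (le_trans h); apply: le_outer_measure.
  by apply: (big_ind (fun B => B `<=` X)) => // B C BX CX; rewrite subUset.
elim: n => [|n ih]; first by rewrite !big_ord0 outer_measure0.
rewrite !big_ord_recr/=; apply: le_trans (leeD2r _ ih) _.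
case: n {ih} => [|n].
  by rewrite !big_ord0 outer_measure0 add0e set0U.
rewrite addeC setUC; apply: (@mu_sep _ _ (u n.+1) (\big[Order.min/l 0%N]_(i < n.+1) l i)).
- apply/bigmin_gtP; split => [|i _]; last exact/ul/ltn_ord.
  exact: ul.
- by move=> x /Alu[].
- move=> x; rewrite -bigcup_mkord => -[i /= ni] /Alu[lx _].
  by apply: le_trans lx; exact: (@bigmin_le_cond _ _ _ (l 0%N) (Ordinal ni)).
Qed.

(** A test set [X] splits into its part in [f <= a] and its part in [f > a],
    which touch. Cut the second at [a + 1 / (n + 1)]: what lies above is
    separated from the first part, and what lies below is a union of shells
    [h k.+1 <= f < h k]. Shells whose indices have the same parity are
    separated from each other, so the series of their measures is bounded by
    [2 * mu X], and the measure of the part that was cut off is at most its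
    tail. *)
Lemma caratheodory_sublevel (a : R) : mu.-caratheodory [set x | (f x <= a)%R].
Proof.
apply: le_caratheodory_measurable => X.
have [->|Xfin] := eqVneq (mu X) +oo; first exact: leey.
pose h (k : nat) : R := (a + k.+1%:R^-1)%R.
have hlt i j : (i < j)%N -> (h j < h i)%R.
  by move=> ij; rewrite /h ltrD2l ltf_pV2 ?posrE ?ltr_nat ?ltr0n.
have hle i j : (i <= j)%N -> (h j <= h i)%R.
  by rewrite leq_eqVlt => /predU1P[->//|/hlt/ltW].
pose Sh k := X `&` [set x | (h k.+1 <= f x)%R /\ (f x < h k)%R].
pose B k := X `&` [set x | (h k <= f x)%R].
(* e is the parity of the shells; two shells of one parity leave a shell between them *)
have sum_par (e n : nat) : \sum_(i < n) mu (Sh (i.*2 + e)%N) <= mu X.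
  apply: (@sum_separated_le X (fun i => Sh (i.*2 + e)%N)
    (fun i => h (i.*2 + e).+1) (fun i => h (i.*2 + e)%N)).
  - by move=> i x [].
  - by move=> i x [_ [? /ltW]].
  - move=> i j ij; apply: hlt.
    by rewrite -addSn ltn_add2r -addn1 -addnn -addnn; lia.
have sum2 n : \sum_(k < n.*2) mu (Sh k) =
    \sum_(i < n) mu (Sh (i.*2 + 0)%N) + \sum_(i < n) mu (Sh (i.*2 + 1)%N).
  elim: n => [|n ih]; first by rewrite !big_ord0 adde0.
  by rewrite doubleS !big_ord_recr/= ih addn0 addn1 -!addeA; congr (_ + _); rewrite addeCA.
have shell_fin : \sum_(k <oo) mu (Sh k) < +oo.
  apply: (@le_lt_trans _ _ (mu X + mu X)); last by rewrite lte_add_pinfty// ltey.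
  apply: lime_le; first by apply: is_cvg_nneseries => *; exact: outer_measure_ge0.
  apply: nearW => n; apply: (@le_trans _ _ (\sum_(k < n.*2) mu (Sh k))).
    rewrite big_mkord -addnn big_split_ord/= leeDl// sume_ge0// => i _.
    exact: outer_measure_ge0.
  rewrite sum2; exact: leeD.
have tail0 := nneseries_tail_cvg shell_fin (fun k _ => outer_measure_ge0 mu (Sh k)).
set A := [set x | _].
have bound n : mu (X `&` A) + mu (X `&` ~` A) <= mu X + \sum_(n <= k <oo) mu (Sh k).
  have cover : X `&` ~` A `<=` B n `|` \bigcup_(k in ~` `I_n) Sh k.
    move=> x [Xx /negP]; rewrite -ltNge => afx.
    have [hfx|hfx] := leP (h n) (f x); [by left|right].
    have : exists k, (h k <= f x)%R.
      have : (0 < f x - a)%R by rewrite subr_gt0.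
      move=> /[dup] fa0 /ltr_add_invr[k]; rewrite add0r => kfa.
      by exists k; rewrite /h -lerBrDl ltW.
    move=> ex; have [m' hm' mmin] := ex_minnP ex.
    have nm' : (n < m')%N.
      by rewrite ltnNge; apply/negP => /hle hn; move: (lt_le_trans hfx (le_trans hn hm')); rewrite ltxx.
    case: m' hm' mmin nm' => // m' hm' mmin nm'.
    exists m'; first by apply/negP; rewrite -leqNgt.
    split => //; split => //; rewrite ltNge; apply/negP => /mmin; lia.
  have AB : mu (X `&` A) + mu (B n) <= mu X.
    have ah : (a < h n)%R by rewrite ltrDl invr_gt0.
    apply: le_trans (mu_sep ah _ _) _.
    - by move=> x [].
    - by move=> x [].
    - by apply: le_outer_measure => x [[]|[]].
  apply: le_trans (leeD2r _ AB); rewrite -addeA; apply: leeD2l.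
  apply: (le_trans (le_outer_measure mu _ _ cover)).
  apply: (le_trans (outer_measureU2 mu _ _)); apply: leeD2l.
  exact: outer_measure_sigma_subadditive_tail.
suff : limn (fun n => mu X + \sum_(n <= k <oo) mu (Sh k)) = mu X.
  move=> <-; apply: lime_ge; last exact: nearW.
  apply: is_cvgeD; [|exact: is_cvg_cst|by apply/cvg_ex; exists 0].
  by rewrite (cvg_lim _ tail0)// fin_num_adde_defl.
apply/cvg_lim => //; rewrite -[X in _ --> X]adde0.
apply: cvgeD => //; [by rewrite fin_num_adde_defl|exact: cvg_cst].
Qed.

End separated_outer_measure.

(** * Hausdorff measure as an outer measure *)

Section euclidean_norm.
Context (R : realType).
Implicit Types x y : pt R.

Lemma enorm_ge0 x : 0 <= enorm x. Proof. exact: sqrtr_ge0. Qed.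

Lemma coord_le_enorm x :
  [/\ `|x.1.1| <= enorm x, `|x.1.2| <= enorm x & `|x.2| <= enorm x].
Proof.
have h1 := sqr_ge0 x.1.1; have h2 := sqr_ge0 x.1.2; have h3 := sqr_ge0 x.2.
by split; rewrite -sqrtr_sqr ler_wsqrtr//; lra.
Qed.

Lemma enorm_le_sum x : enorm x <= `|x.1.1| + `|x.1.2| + `|x.2|.
Proof.
rewrite -[leRHS]ger0_norm ?addr_ge0// -sqrtr_sqr ler_wsqrtr//.
rewrite -(real_normK (num_real x.1.1)) -(real_normK (num_real x.1.2)).
rewrite -(real_normK (num_real x.2)).
have := normr_ge0 x.1.1; have := normr_ge0 x.1.2; have := normr_ge0 x.2.
by nra.
Qed.

Lemma enormZ (a : R) x : enorm (a *: x) = `|a| * enorm x.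
Proof.
rewrite /enorm -sqrtr_sqr -sqrtrM ?sqr_ge0//; congr Num.sqrt => /=.
by rewrite !exprMn -!mulrDr.
Qed.

End euclidean_norm.

Section hausdorff.
Local Open Scope ereal_scope.
Context (R : realType).
Implicit Types (A B U : set (pt R)).

Lemma ediam_ge0 U : 0 <= ediam U.
Proof. by apply: ereal_sup_ubound; left. Qed.

Lemma ediam_le U (d : R) : (0 <= d)%R ->
  (forall x y, U x -> U y -> (enorm (x - y) <= d)%R) -> ediam U <= d%:E.
Proof.
move=> d0 Ud; apply: ge_ereal_sup => _ [->|[[x y] [/= Ux Uy] <-]].
- by rewrite lee_fin.
- by rewrite lee_fin Ud.
Qed.

Lemma enorm_le_ediam U x y : U x -> U y -> (enorm (x - y))%:E <= ediam U.
Proof. by move=> Ux Uy; apply: ereal_sup_ubound; right; exists (x, y). Qed.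

Lemma ediam0 : ediam (set0 : set (pt R)) = 0.
Proof. by apply/eqP; rewrite eq_le ediam_ge0 ediam_le. Qed.

Lemma ediam_image_le (c : pt R) (e : R) U : (0 < e)%R ->
  ediam [set (c + e *: x)%R | x in U] <= e%:E * ediam U.
Proof.
move=> e0; apply: ge_ereal_sup => _ [->|[[_ _] [/= [x Ux <-] [y Uy <-]] <-]].
  by rewrite mule_ge0 ?ediam_ge0// lee_fin ltW.
rewrite (_ : _ - _ = e *: (x - y))%R; last by rewrite scalerBr opprD addrACA subrr add0r.
rewrite enormZ gtr0_norm// EFinM.
by apply: lee_wpmul2l; [rewrite lee_fin ltW|exact: enorm_le_ediam].
Qed.

Definition dgauge U : \bar R := (pi / 4)%:E * ediam U ^+ 2.

Lemma pi4_ge0 : (0 <= pi / 4 :> R)%R.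
Proof. by rewrite divr_ge0 ?pi_ge0. Qed.

Lemma dgauge_ge0 U : 0 <= dgauge U.
Proof. by rewrite mule_ge0 ?expe_ge0 ?ediam_ge0// lee_fin pi4_ge0. Qed.

Lemma dgauge0 : dgauge set0 = 0.
Proof. by rewrite /dgauge ediam0 expe2 !mule0. Qed.

Definition delta_cover (d : R) A : set (nat -> set (pt R)) :=
  [set U | A `<=` \bigcup_i U i /\ forall i, ediam (U i) <= d%:E].

Definition delta_surf (d : R) A : \bar R :=
  ereal_inf [set \sum_(0 <= i <oo) dgauge (U i) | U in delta_cover d A].

Lemma delta_surf_anti (d1 d2 : R) A : (d1 <= d2)%R -> delta_surf d2 A <= delta_surf d1 A.
Proof.
move=> d12; apply: ereal_inf_le_tmp => _ [U [AU Ud] <-]; exists U => //.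
by split => // i; apply: le_trans (Ud i) _; rewrite lee_fin.
Qed.

Lemma delta_surf_le_surf (d : R) A : (0 < d)%R -> delta_surf d A <= surf A.
Proof. by move=> d0; apply: ereal_sup_ubound; exists d. Qed.

(** The outer measures of the library are built from set functions on a
    sigma-algebra; the coverings in Hausdorff measure are by arbitrary sets,
    hence the sigma-algebra of all subsets. *)
Definition all_sets := g_sigma_algebraType [set: set (pt R)].

Lemma measurable_all_sets (A : set all_sets) : measurable A.
Proof. exact: sub_sigma_algebra. Qed.

(** The value [+oo] on sets of large diameter replaces the constraint on the
    diameters in a covering. *)
Definition capped_gauge (d : R) (U : set all_sets) : \bar R :=
  if ediam (U : set (pt R)) <= d%:E then dgauge U else +oo.

(** Countable subadditivity of the premeasures, hence of [surf], then comes from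
    the general theory of [mu_ext]. *)
Lemma delta_surf_mu_ext (d : R) A : (0 < d)%R ->
  delta_surf d A = mu_ext (capped_gauge d) A.
Proof.
move=> d0; apply/eqP; rewrite eq_le; apply/andP; split; apply: le_ereal_inf_tmp.
- move=> _ [U [_ AU] <-].
  have [Ud|] := pselect (forall i, ediam (U i : set (pt R)) <= d%:E).
    apply: ereal_inf_lbound; exists U => //.
    by apply: eq_eseriesr => i _; rewrite /capped_gauge Ud.
  move=> /existsNP[i /negP Udi].
  rewrite (eseries_pinfty (k := i)) ?leey// /capped_gauge.
    by move=> n _; case: ifP => // _; rewrite -ltNye (lt_le_trans _ (dgauge_ge0 _)).
  by rewrite (negbTE Udi).
- move=> _ [U [AU Ud] <-]; apply: ereal_inf_lbound; exists U.
    by split => // i; exact: measurable_all_sets.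
  by apply: eq_eseriesr => i _; rewrite /capped_gauge Ud.
Qed.

Lemma capped_gauge_ge0 (d : R) U : 0 <= capped_gauge d U.
Proof. by rewrite /capped_gauge; case: ifP => // _; exact: dgauge_ge0. Qed.

Lemma capped_gauge0 (d : R) : (0 < d)%R -> capped_gauge d set0 = 0.
Proof. by move=> d0; rewrite /capped_gauge ediam0 lee_fin ltW// dgauge0. Qed.

Lemma delta_surf_ge0 d A : 0 <= delta_surf d A.
Proof.
apply: le_ereal_inf_tmp => _ [U _ <-]; apply: nneseries_ge0 => i _ _.
exact: dgauge_ge0.
Qed.

Lemma surf_ge0 A : 0 <= surf A.
Proof. exact: (le_trans (delta_surf_ge0 _ _) (delta_surf_le_surf A ltr01)). Qed.

Lemma le_surf : {homo @surf R : A B / A `<=` B >-> A <= B}.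
Proof.
move=> A B AB; apply: ge_ereal_sup => _ [d d0 <-].
apply: le_trans (delta_surf_le_surf B d0).
by apply: ereal_inf_le_tmp => _ [U [BU Ud] <-]; exists U => //; split => //; exact: subset_trans BU.
Qed.

Lemma surf0 : surf (set0 : set (pt R)) = 0.
Proof.
apply/eqP; rewrite eq_le surf_ge0 andbT; apply: ge_ereal_sup => _ [d d0 <-].
rewrite -/(delta_surf _ _) delta_surf_mu_ext// mu_ext0//.
- exact: capped_gauge0.
- exact: capped_gauge_ge0.
Qed.

Lemma surf_sigma_subadditive : sigma_subadditive (@surf R).
Proof.
move=> F; apply: ge_ereal_sup => _ [d d0 <-].
rewrite -/(delta_surf _ _) delta_surf_mu_ext//.
have h := @mu_ext_sigma_subadditive _ all_sets _ _ (capped_gauge_ge0 d) (F : nat -> set all_sets).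
apply: (@le_trans _ _ (\sum_(i <oo) mu_ext (capped_gauge d) (F i))).
  exact: h.
apply: lee_nneseries => i _.
  by move=> _; rewrite -delta_surf_mu_ext// delta_surf_ge0.
by rewrite -delta_surf_mu_ext// delta_surf_le_surf.
Qed.

HB.instance Definition _ := isOuterMeasure.Build R (pt R) (@surf R)
  surf0 surf_ge0 le_surf surf_sigma_subadditive.

(** A set of diameter at most [d] meets only one of [A] and [B], so a covering of
    the union splits into a covering of each. *)
Lemma delta_surf_sep (A B : set (pt R)) (d : R) : (0 < d)%R ->
  (forall x y, A x -> B y -> (d < enorm (x - y))%R) ->
  delta_surf d A + delta_surf d B <= delta_surf d (A `|` B).
Proof.
move=> d0 AB; apply: le_ereal_inf_tmp => _ [U [ABU Ud] <-].
pose W (C : set (pt R)) i := if `[< U i `&` C !=set0 >] then U i else set0.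
have Wcov C : C `<=` A `|` B -> delta_cover d C (W C).
  move=> CAB; split => [x Cx|i]; rewrite /W.
    have [i _ Uix] := ABU x (CAB x Cx).
    by exists i => //; case: asboolP => // -[]; exists x.
  by case: ifP => // _; rewrite ediam0 lee_fin ltW.
apply: (@le_trans _ _ (\sum_(0 <= i <oo) dgauge (W A i) + \sum_(0 <= i <oo) dgauge (W B i))).
  by apply: leeD; apply: ereal_inf_lbound; eexists; try reflexivity; apply: Wcov; [exact: subsetUl|exact: subsetUr].
rewrite -nneseriesD; try by move=> *; exact: dgauge_ge0.
apply: lee_nneseries => i _.
  by move=> _; rewrite adde_ge0// dgauge_ge0.
rewrite /W; case: asboolP => [[x [Ux Ax]]|_]; case: asboolP => [[y [Uy By]]|_];
  rewrite ?dgauge0 ?adde0 ?add0e ?dgauge_ge0//.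
have := le_trans (enorm_le_ediam Ux Uy) (Ud i).
by rewrite lee_fin leNgt AB.
Qed.

Lemma surf_sep (A B : set (pt R)) (e : R) : (0 < e)%R ->
  (forall x y, A x -> B y -> (e <= enorm (x - y))%R) ->
  surf A + surf B <= surf (A `|` B).
Proof.
move=> e0 AB; have [->|/eqP] := eqVneq (surf (A `|` B)) +oo; first exact: leey.
move=> ABoo.
have ABfin : surf (A `|` B) \is a fin_num.
  by rewrite ge0_fin_numE ?surf_ge0// ltey; apply/eqP.
have Bfin : surf B \is a fin_num.
  rewrite ge0_fin_numE ?surf_ge0//; apply: (@le_lt_trans _ _ (surf (A `|` B))).
    exact: le_surf.
  by rewrite ltey; apply/eqP.
rewrite -leeBrDr//; apply: ge_ereal_sup => _ [d1 d10 <-].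
rewrite -/(delta_surf _ _) leeBrDr// addeC.
have d1Bfin : delta_surf d1 A \is a fin_num.
  rewrite ge0_fin_numE ?delta_surf_ge0//; apply: (le_lt_trans (delta_surf_le_surf _ d10)).
  apply: (@le_lt_trans _ _ (surf (A `|` B))); first exact: le_surf.
  by rewrite ltey; apply/eqP.
rewrite -leeBrDr//; apply: ge_ereal_sup => _ [d2 d20 <-].
rewrite -/(delta_surf _ _) leeBrDr// addeC.
pose d := (Num.min (Num.min d1 d2) (e / 2))%R.
have d0 : (0 < d)%R by rewrite !lt_min d10 d20/= divr_gt0.
apply: (@le_trans _ _ (delta_surf d A + delta_surf d B)).
  by apply: leeD; apply: delta_surf_anti; rewrite !ge_min lexx ?orbT.
apply: le_trans (delta_surf_le_surf _ d0).
apply: delta_surf_sep => // x y Ax By.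
apply: lt_le_trans (AB x y Ax By); rewrite /d gt_min; apply/orP; right; lra.
Qed.

End hausdorff.

(** * Hausdorff measure as a Borel measure *)

Section surface_borel.
Local Open Scope ereal_scope.
Context (R : realType).

(** Sets separated by a 1-Lipschitz function are at positive distance. *)
Lemma caratheodory_coordinate (f : pt R -> measurableTypeR R) :
  (forall x y, (`|f x - f y| <= enorm (x - y))%R) ->
  forall a, (@surf R).-caratheodory [set x | (f x <= a)%R].
Proof.
move=> fl a; apply: caratheodory_sublevel => A B r s rs Ar Bs.
apply: (@surf_sep _ _ _ (s - r)); first by rewrite subr_gt0.
move=> x y /Ar/= xr /Bs/= sy; apply: le_trans (fl x y).
by rewrite distrC (le_trans _ (ler_norm _))// lerB.
Qed.

Lemma measurable_caratheodory_coordinate (f : pt R -> measurableTypeR R) :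
  (forall x y, (`|f x - f y| <= enorm (x - y))%R) ->
  measurable_fun setT (f : caratheodory_type (@surf R) -> measurableTypeR R).
Proof.
move=> fl; apply: (measurability _ (RGenOInfty.measurableE R)) => //.
move=> _ [_ [a ->] <-]; rewrite setTI.
rewrite [X in measurable X](_ : _ = ~` [set x | (f x <= a)%R]).
  by apply: measurableC; exact: caratheodory_coordinate.
by apply/seteqP; split => x /=; rewrite in_itv/= andbT ltNge => /negP.
Qed.

(** The Borel structure on [pt R] is the product one, generated by the
    coordinates; these are 1-Lipschitz, hence measurable for the Caratheodory
    sigma-algebra. *)
Lemma measurable_surf_caratheodory (A : set (pt R)) :
  measurable A -> (@surf R).-caratheodory A.
Proof.
move=> mA.
pose idc : caratheodory_type (@surf R) -> pt R := fun x => (x.1.1, x.1.2, x.2).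
have mid : measurable_fun setT idc.
  apply: measurable_fun_pair; last first.
    by apply: measurable_caratheodory_coordinate => x y; have [] := coord_le_enorm (x - y)%R.
  apply: measurable_fun_pair;
    by apply: measurable_caratheodory_coordinate => x y; have [] := coord_le_enorm (x - y)%R.
have := mid measurableT A mA; rewrite setTI (_ : idc @^-1` A = A)//.
by apply/seteqP; split => -[[]].
Qed.

Lemma surf_semi_sigma_additive : semi_sigma_additive (@surf R).
Proof.
move=> F mF tF mUF; apply: (@caratheodory_measure_sigma_additive R (pt R) (@surf R)) => //.
- by move=> i; exact: measurable_surf_caratheodory.
- exact: measurable_surf_caratheodory.
Qed.

HB.instance Definition _ := isMeasure.Build _ (pt R) R (@surf R)
  (@surf0 R) (@surf_ge0 R) surf_semi_sigma_additive.

End surface_borel.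

Section borel_open.
Context (R : realType).

Definition box (p : rat * rat * rat * nat) : set (pt R) :=
  [set x | [/\ `|x.1.1 - ratr p.1.1.1| < p.2.+1%:R^-1, `|x.1.2 - ratr p.1.1.2| < p.2.+1%:R^-1
             & `|x.2 - ratr p.1.2| < p.2.+1%:R^-1]].

Lemma measurable_coord1 : measurable_fun setT (fun x : pt R => x.1.1).
Proof. exact: measurableT_comp. Qed.
Lemma measurable_coord2 : measurable_fun setT (fun x : pt R => x.1.2).
Proof. exact: measurableT_comp. Qed.
Lemma measurable_coord3 : measurable_fun setT (fun x : pt R => x.2).
Proof. exact: measurable_snd. Qed.

Lemma measurable_rect (I J K : set (measurableTypeR R)) :
  measurable I -> measurable J -> measurable K ->
  measurable [set x : pt R | [/\ I x.1.1, J x.1.2 & K x.2]].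
Proof.
move=> mI mJ mK; rewrite (_ : [set x | _] = (I `*` J) `*` K).
  by apply: measurableX => //; exact: measurableX.
by apply/seteqP; split => [x [? ? ?]//|x [[? ?] ?]].
Qed.

(** The measurable sets of [pt R] are those of a product of sigma-algebras; an
    open set is among them because it is a countable union of boxes with
    rational centres. *)
Lemma open_measurable3 (A : set (pt R)) : open A -> measurable A.
Proof.
move=> oA.
have -> : A = \bigcup_(p in [set p | box p `<=` A]) box p.
  apply/seteqP; split => [x Ax|x [p /= pA] /pA//].
  have /nbhs_ballP[e /= e0 eA] : nbhs x A by exact: open_nbhs_nbhs.
  have e20 : 0 < e / 2 by rewrite divr_gt0.
  have [k ke] := ltr_add_invr e20.
  rewrite add0r in ke.
  have rat_near (t : R) : exists q : rat, `|t - ratr q| < k.+1%:R^-1.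
    have : t - k.+1%:R^-1 < t + k.+1%:R^-1.
      by rewrite ltrD2l gtrN// invr_gt0.
    move=> /rat_in_itvoo[q]; rewrite in_itv/= => /andP[h1 h2].
    by exists q; rewrite distrC ltr_distl h1 h2.
  have [q1 h1] := rat_near x.1.1; have [q2 h2] := rat_near x.1.2.
  have [q3 h3] := rat_near x.2.
  exists (q1, q2, q3, k) => //= y [/= y1 y2 y3]; apply: eA.
  have tri (a b q : R) : `|a - q| < k.+1%:R^-1 -> `|b - q| < k.+1%:R^-1 -> `|a - b| < e.
    move=> aq bq; rewrite (_ : a - b = (a - q) - (b - q)); last by ring.
    apply: le_lt_trans (ler_normB _ _) _.
    by move: ke aq bq; set z := k.+1%:R^-1 => ke aq bq; lra.
  by split; [split|]; rewrite /ball/=; apply: tri; eassumption.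
rewrite bigcup_mkcond; apply: countable_bigcupT_measurable => // p.
case: ifP => // _.
have mball (q : rat) : measurable [set x : measurableTypeR R | `|x - ratr q| < p.2.+1%:R^-1].
  have -> : [set x : measurableTypeR R | `|x - ratr q| < p.2.+1%:R^-1] = `]ratr q - p.2.+1%:R^-1, ratr q + p.2.+1%:R^-1[%classic.
    by apply/seteqP; split => x /=; rewrite in_itv/= ltr_distl.
  exact: measurable_itv.
exact: (measurable_rect (mball _) (mball _) (mball _)).
Qed.

Lemma closed_measurable3 (A : set (pt R)) : closed A -> measurable A.
Proof. by move=> /closed_openC/open_measurable3/measurableC; rewrite setCK. Qed.

End borel_open.

Section integral_restriction_scaling.
Local Open Scope ereal_scope.
Context d (T : measurableType d) (R : realType).
Variable mu : {measure set T -> \bar R}.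

Lemma ge0_integral_mrestr (D : set T) (mD : measurable D) (f : T -> \bar R) :
  measurable_fun setT f -> (forall x, 0 <= f x) ->
  \int[mrestr mu mD]_x f x = \int[mu]_(x in D) f x.
Proof.
move=> mf f0; rewrite -(setUv D) ge0_integral_setU//; last 3 first.
- exact: measurableC.
- by rewrite setUv.
- by apply/disj_setPCl.
rewrite (eq_measure_integral mu); last first.
  by move=> A mA AD; rewrite /= /mrestr (setIidl AD).
rewrite [X in _ + X](_ : _ = 0) ?adde0//.
rewrite (eq_measure_integral mzero) ?integral_measure_zero// => A mA AD.
by rewrite /= /mrestr (_ : A `&` D = set0) ?measure0// -subset0 => x [/AD].
Qed.

(** Common form of the changes of variables for area and volume. *)
Lemma ge0_integral_scaling (tau : T -> T) (k : R) : measurable_fun setT tau ->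
  (0 <= k)%R -> (forall A, measurable A -> mu A = k%:E * mu (tau @^-1` A)) ->
  forall (D : set T) (f : T -> \bar R), measurable D -> measurable_fun D f ->
  (forall x, D x -> 0 <= f x) ->
  \int[mu]_(x in D) f x = k%:E * \int[mu]_(x in tau @^-1` D) f (tau x).
Proof.
move=> mtau k0 muk D f mD mf f0.
rewrite -(ge0_integral_pushforward mtau)//; last by move=> x /set_mem; exact: f0.
rewrite -(@ge0_integral_mscale _ _ _ _ _ mD (NngNum k0) _ mf)//.
by apply: eq_measure_integral => A mA AD /=; rewrite muk.
Qed.

End integral_restriction_scaling.

Section affine.
Local Open Scope ereal_scope.
Context (R : realType) (c : pt R) (e : R) (e0 : (0 < e)%R).

Definition affine (x : pt R) : pt R := (c + e *: x)%R.
Definition affine_inv (x : pt R) : pt R := (e^-1 *: (x - c))%R.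

Lemma affineK : cancel affine affine_inv.
Proof.
by move=> x; rewrite /affine /affine_inv addrAC subrr add0r scalerA mulVf ?scale1r ?gt_eqF.
Qed.

Lemma affine_invK : cancel affine_inv affine.
Proof.
by move=> x; rewrite /affine /affine_inv scalerA mulfV ?gt_eqF// scale1r addrC subrK.
Qed.

Lemma measurable_affine : measurable_fun setT affine.
Proof.
have m1 (a b : R) : measurable_fun setT (fun t : measurableTypeR R => a + b * t : measurableTypeR R)%R.
  by apply: measurable_funD => //; exact: measurable_funM.
apply: measurable_fun_pair; [apply: measurable_fun_pair|].
- exact: (measurableT_comp (m1 c.1.1 e) (@measurable_coord1 R)).
- exact: (measurableT_comp (m1 c.1.2 e) (@measurable_coord2 R)).
- exact: (measurableT_comp (m1 c.2 e) (@measurable_coord3 R)).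
Qed.

Lemma image_affine A : affine @` A = affine_inv @^-1` A.
Proof.
apply/seteqP; split => [_ [x Ax <-]|x Ax] /=; first by rewrite affineK.
by exists (affine_inv x) => //; rewrite affine_invK.
Qed.

Lemma surf_affine_le A : surf (affine @` A) <= (e ^+ 2)%:E * surf A.
Proof.
apply: ge_ereal_sup => _ [d d0 <-]; rewrite -/(delta_surf _ _).
have de0 : (0 < d / e)%R by rewrite divr_gt0.
apply: (@le_trans _ _ ((e ^+ 2)%:E * delta_surf (d / e) A)); last first.
  by apply: lee_wpmul2l; [rewrite lee_fin sqr_ge0|exact: delta_surf_le_surf].
rewrite -lee_pdivrMl ?exprn_gt0//; apply: le_ereal_inf_tmp => _ [U [AU Ud] <-].
rewrite lee_pdivrMl ?exprn_gt0//.
pose V i := affine @` U i.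
have Vd i : ediam (V i) <= e%:E * ediam (U i) by exact: ediam_image_le.
apply: (@le_trans _ _ (\sum_(0 <= i <oo) dgauge (V i))).
  apply: ereal_inf_lbound; exists V => //; split.
    by move=> _ [x /AU[i _ Uix] <-]; exists i => //; exists x.
  move=> i; apply: le_trans (Vd i) _.
  apply: (@le_trans _ _ (e%:E * (d / e)%:E)).
    by apply: lee_wpmul2l; [rewrite lee_fin ltW|exact: Ud].
  by rewrite -EFinM lee_fin mulrC divfK ?gt_eqF.
rewrite -nneseriesZl; last by move=> i _; exact: dgauge_ge0.
  apply: lee_nneseries => i _; first by move=> _; exact: dgauge_ge0.
  rewrite /dgauge [in leRHS]muleCA; apply: lee_wpmul2l; first by rewrite lee_fin pi4_ge0.
  rewrite !expe2 EFin_expe expe2 muleACA.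
  by apply: lee_pmul => //; exact: ediam_ge0.
Qed.

End affine.

(** * Homotheties scale area and volume *)

Section affine_measures.
Local Open Scope ereal_scope.
Context (R : realType) (c : pt R) (e : R) (e0 : (0 < e)%R).
Local Notation tau := (affine c e).

Lemma image_preimage_affine A : tau @` (tau @^-1` A) = A.
Proof.
apply/seteqP; split => [_ [x Ax <-]//|x Ax].
by exists (affine_inv c e x); rewrite /= ?affine_invK.
Qed.

Lemma preimage_image_affine A : tau @^-1` (tau @` A) = A.
Proof.
apply/seteqP; split => [x [y Ay /(can_inj (affineK c e0)) <-]//|x Ax].
by exists x.
Qed.

Lemma measurable_image_affine A : measurable A -> measurable (tau @` A).
Proof.
move=> mA; rewrite image_affine//.
have -> : affine_inv c e = affine (- (e^-1 *: c))%R e^-1.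
  by apply/funext => x; rewrite /affine_inv /affine scalerBr addrC.
by rewrite -[X in measurable X]setTI; exact: measurable_affine.
Qed.

Lemma surf_affine A : surf (tau @` A) = (e ^+ 2)%:E * surf A.
Proof.
apply/eqP; rewrite eq_le surf_affine_le//=.
rewrite -lee_pdivlMl ?exprn_gt0// -exprVn.
have ei0 : (0 < e^-1)%R by rewrite invr_gt0.
apply: le_trans (surf_affine_le (- (e^-1 *: c))%R ei0 _).
apply: le_surf => x Ax; exists (tau x); first by exists x.
by rewrite /affine scalerDr addKr scalerA mulVf ?scale1r// gt_eqF.
Qed.

Lemma surf_integral_affine (G : set (pt R)) (f : pt R -> \bar R) :
  measurable G -> measurable_fun (tau @` G) f ->
  (forall x, (tau @` G) x -> 0 <= f x) ->
  \int[@surf R]_(x in tau @` G) f x = (e ^+ 2)%:E * \int[@surf R]_(x in G) f (tau x).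
Proof.
move=> mG mf f0; rewrite (ge0_integral_scaling (@measurable_affine R c e) (sqr_ge0 e))//.
- by rewrite preimage_image_affine.
- by move=> A mA; rewrite -surf_affine image_preimage_affine.
- exact: measurable_image_affine.
Qed.

(** By uniqueness of Lebesgue measure among the measures giving intervals their
    length. *)
Lemma lebesgue_measure_affine (a : R) (A : set (measurableTypeR R)) : measurable A ->
  (@lebesgue_measure R) A = e%:E * lebesgue_measure ((fun t => a + e * t)%R @^-1` A).
Proof.
pose t1 : measurableTypeR R -> measurableTypeR R := (fun t => a + e * t)%R.
have mt1 : measurable_fun setT t1 by apply: measurable_funD => //; exact: measurable_funM.
have ge0e : (0 <= e)%R by exact: ltW.
move: A; apply: (@lebesgue_measure_unique R (mscale (NngNum ge0e) (pushforward lebesgue_measure t1))).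
move=> _ [[b d] _ <-]; rewrite /mscale/= /pushforward.
rewrite [X in _ = _ * lebesgue_measure X](_ : _ = `]((b - a) / e)%R, ((d - a) / e)%R]%classic); last first.
  apply/seteqP; split => t /=; rewrite !in_itv/= /t1 ltr_pdivrMr// ler_pdivlMr//;
  by rewrite ltrBlDl lerBrDl mulrC.
rewrite !lebesgue_measure_itv/= !lte_fin ltr_pM2r ?invr_gt0// ltrD2r.
case: ifPn; rewrite ?mule0// => _; rewrite -!EFinB -EFinM -mulrBl mulrC divfK ?gt_eqF//.
by rewrite opprB addrA subrK.
Qed.

(** One coordinate at a time: uniqueness of the product measure in the plane, then
    integration of the lengths of the sections. *)
Lemma leb3_affine A : measurable A -> leb3 R A = (e ^+ 3)%:E * leb3 R (tau @^-1` A).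
Proof.
have ge0e n : (0 <= e ^+ n)%R by rewrite exprn_ge0// ltW.
have mtau := @measurable_affine R c e.
pose leb2 := (@lebesgue_measure R \x @lebesgue_measure R).
pose t2 : measurableTypeR R * measurableTypeR R -> measurableTypeR R * measurableTypeR R :=
  fun x => (c.1 + e *: x)%R.
have m1 (a : R) : measurable_fun setT (fun t : measurableTypeR R => a + e * t : measurableTypeR R)%R.
  by apply: measurable_funD => //; exact: measurable_funM.
have m1T (a : R) B : measurable B -> measurable ((fun t : measurableTypeR R => a + e * t : measurableTypeR R)%R @^-1` B).
  by move=> mB; rewrite -[X in measurable X]setTI; exact: m1.
have mt2 : measurable_fun setT t2.
  apply: measurable_fun_pair.
  - exact: (measurableT_comp (m1 c.1.1) measurable_fst).
  - exact: (measurableT_comp (m1 c.1.2) measurable_snd).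
have t2E B : measurable B -> leb2 B = (e ^+ 2)%:E * leb2 (t2 @^-1` B).
  move: B; apply: (@product_measure_unique _ _ _ _ _ (@lebesgue_measure R) (@lebesgue_measure R)
    (mscale (NngNum (ge0e 2%N)) (pushforward leb2 t2))).
  move=> B C mB mC; rewrite /mscale/= /pushforward.
  rewrite [X in _ * leb2 X = _](_ : _ = ((fun t : measurableTypeR R => c.1.1 + e * t : measurableTypeR R)%R @^-1` B) `*`
    ((fun t : measurableTypeR R => c.1.2 + e * t : measurableTypeR R)%R @^-1` C)); last first.
    by apply/seteqP; split.
  rewrite [leb2 _]product_measure1E ?(lebesgue_measure_affine c.1.1 mB) ?(lebesgue_measure_affine c.1.2 mC) //; try exact: m1T.
  by rewrite [in RHS]muleACA -EFinM -expr2.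
move=> mA.
have mxs := @measurable_fun_xsection _ _ _ _ _ (@lebesgue_measure R) _ mA.
transitivity (\int[leb2]_x (lebesgue_measure \o xsection A) x)%E; first by [].
rewrite (ge0_integral_scaling mt2 (ge0e 2%N) t2E)// preimage_setT.
have -> : (e ^+ 3)%:E = (e ^+ 2)%:E * e%:E by rewrite -EFinM -exprSr.
rewrite -[in RHS]muleA; congr (_ * _).
have mtA : measurable (tau @^-1` A) by rewrite -[X in measurable X]setTI; exact: mtau.
transitivity (e%:E * \int[leb2]_x (lebesgue_measure \o xsection (tau @^-1` A)) x)%E; last by [].
rewrite -ge0_integralZl//; last 2 first.
- exact: measurable_fun_xsection.
- by rewrite lee_fin ltW.
apply: eq_integral => x _ /=.
rewrite (lebesgue_measure_affine c.2 (measurable_xsection _ mA)).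
congr (_ * lebesgue_measure _); apply/seteqP; split => t;
  by rewrite /xsection/= !inE.
Qed.

Lemma leb3_integral_affine (G : set (pt R)) (f : pt R -> \bar R) :
  measurable G -> measurable_fun (tau @` G) f ->
  (forall x, (tau @` G) x -> 0 <= f x) ->
  \int[@leb3 R]_(x in tau @` G) f x = (e ^+ 3)%:E * \int[@leb3 R]_(x in G) f (tau x).
Proof.
move=> mG mf f0; rewrite (@ge0_integral_scaling _ _ _ _ tau (e ^+ 3))//.
- by rewrite preimage_image_affine.
- exact: measurable_affine.
- by rewrite exprn_ge0// ltW.
- by move=> A mA; exact: leb3_affine.
- exact: measurable_image_affine.
Qed.

End affine_measures.

Section unit_cube.
Context (R : realType).

Lemma unit_cubeE : @unit_cube R = [set x | [/\ `]0, 1[%classic x.1.1, `]0, 1[%classic x.1.2 & `]0, 1[%classic x.2]].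
Proof. by apply/seteqP; split => x; rewrite /unit_cube/= !in_itv. Qed.

Lemma measurable_unit_cube : measurable (@unit_cube R).
Proof. by rewrite unit_cubeE; apply: measurable_rect; exact: measurable_itv. Qed.

Lemma leb3_unit_cube : leb3 R (@unit_cube R) = 1%E.
Proof.
rewrite unit_cubeE (_ : [set x | _] = (`]0%R, 1%R[%classic `*` `]0%R, 1%R[%classic) `*` `]0%R, 1%R[%classic).
  rewrite [LHS]product_measure1E//; try (by apply: measurableX; exact: measurable_itv); try exact: measurable_itv.
  rewrite [X in (X * _)%E]product_measure1E; try exact: measurable_itv.
  by rewrite /= lebesgue_measure_itv/= lte_fin ltr01 oppr0 !adde0 !mule1.
by apply/seteqP; split => [x [? ? ?]//|x [[? ?] ?]].
Qed.

End unit_cube.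

(** * Area of Lipschitz graphs *)

Section graph_area.
Context (R : realType).

(** A set on which two bounded functions [p1] and [p2] are coordinates with a
    Lipschitz inverse. Cut the square of side [2 * M] of the values of
    [(p1, p2)] into [N * N] squares: the corresponding pieces have diameter
    [O (1 / N)], so the sum of the squares of the diameters stays bounded while
    the diameters tend to 0. *)
Lemma surf_graph_lty (P : set (pt R)) (p1 p2 : pt R -> R) (M C : R) :
  0 < M -> 0 <= C ->
  (forall x, P x -> `|p1 x| < M /\ `|p2 x| < M) ->
  (forall x y, P x -> P y -> enorm (x - y) <= C * (`|p1 x - p1 y| + `|p2 x - p2 y|)) ->
  (surf P < +oo)%E.
Proof.
move=> M0 C0 pM plip; apply: (@le_lt_trans _ _ (pi / 4 * (4 * C * M) ^+ 2)%:E); last exact: ltry.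
apply: ge_ereal_sup => _ [d /= d0 <-]; rewrite -/(delta_surf _ _).
(* N is large enough for the diameter C * (2 * w) of a piece to be at most d *)
have [N0 hN0] : exists N0 : nat, 4 * C * M / d < N0%:R.
  by exists (Num.truncn (4 * C * M / d)).+1; exact: truncnS_gt.
pose N := N0.+1; have [n nE] : exists n : R, n = N%:R by exists N%:R.
have N_gt0 : 0 < n by rewrite nE ltr0n.
pose w := 2 * M / n.
have w0 : 0 < w by rewrite divr_gt0// mulr_gt0.
have wN : w * n = 2 * M by rewrite /w divfK// gt_eqF.
have wd : C * (2 * w) <= d.
  have : 4 * C * M <= d * n.
    move: hN0; rewrite ltr_pdivrMr// => /ltW/le_trans; apply.
    by rewrite mulrC ler_pM2l// nE ler_nat leqnSn.
  move=> h; rewrite -(ler_pM2r N_gt0); apply: le_trans h.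
  rewrite (_ : C * (2 * w) * n = C * 2 * (w * n)); last by ring.
  by rewrite wN; lra.
pose id (t : R) := Num.truncn ((t + M) / w).
have idP (t : R) : `|t| < M -> (id t < N)%N /\ (id t)%:R * w <= t + M < (id t).+1%:R * w.
  rewrite ltr_norml => /andP[tM Mt].
  have t0 : 0 <= (t + M) / w by rewrite divr_ge0 ?(ltW w0)// -lerBlDr sub0r ltW.
  have /andP[h1 h2] := truncn_itv t0.
  split; last by rewrite -ler_pdivlMr// -ltr_pdivrMr// h1.
  rewrite -(ltr_nat R) -nE; apply: le_lt_trans h1 _.
  by rewrite ltr_pdivrMr// mulrC wN; lra.
have idlip (s t : R) : `|s| < M -> `|t| < M -> id s = id t -> `|s - t| <= w.
  move=> /idP[_ /andP[s1 s2]] /idP[_ /andP[t1 t2]] e.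
  rewrite e in s1 s2; rewrite -natr1 mulrDl mul1r in s2 t2.
  by rewrite ler_norml; apply/andP; split; lra.
pose U (k : nat) := P `&` [set x | (id (p1 x) * N + id (p2 x))%N = k].
have Udiam k : (ediam (U k) <= (C * (2 * w))%:E)%E.
  apply: ediam_le; first by apply: mulr_ge0 => //; apply: mulr_ge0 => //; exact: ltW.
  move=> x y [Px xk] [Py yk]; apply: le_trans (plip _ _ Px Py) _.
  have [x1 x2] := pM x Px; have [y1 y2] := pM y Py.
  have [i1 _] := idP _ x2; have [i2 _] := idP _ y2.
  have e2 : id (p2 x) = id (p2 y).
    have : ((id (p1 x) * N + id (p2 x)) %% N = (id (p1 y) * N + id (p2 y)) %% N)%N.
      by rewrite xk yk.
    by rewrite !modnMDl !modn_small.
  have e1 : id (p1 x) = id (p1 y).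
    have : (id (p1 x) * N + id (p2 y) = id (p1 y) * N + id (p2 y))%N.
      by rewrite -{1}e2 xk yk.
    by move=> /addIn/eqP; rewrite eqn_mul2r => /orP[//|/eqP].
  apply: ler_wpM2l => //; rewrite mulr_natl mulr2n; apply: lerD; exact: idlip.
apply: (@le_trans _ _ (\sum_(0 <= k <oo) dgauge (U k))%E).
  apply: ereal_inf_lbound; exists U => //; split.
    by move=> x Px; exists (id (p1 x) * N + id (p2 x))%N.
  by move=> k; apply: le_trans (Udiam k) _; rewrite lee_fin.
rewrite (nneseries_split _ (N * N)); last by move=> k _; exact: dgauge_ge0.
rewrite [X in (_ + X)%E]eseries0 ?adde0; last first.
  move=> k Nk _; rewrite (_ : U k = set0) ?dgauge0// -subset0 => x [Px xk].
  have [x1 x2] := pM x Px; have [i1 _] := idP _ x1; have [i2 _] := idP _ x2.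
  have : (id (p1 x) * N + id (p2 x) < N * N)%N.
    apply: (@leq_trans ((id (p1 x)).+1 * N)); last by rewrite leq_pmul2r.
    by rewrite mulSn addnC ltn_add2r.
  by move: xk Nk => /= ->; rewrite add0n leqNgt => /negP.
apply: (@le_trans _ _ (\sum_(0 <= k < N * N) (pi / 4 * (C * (2 * w)) ^+ 2)%:E)%E).
  rewrite add0n; apply: lee_sum => k _; rewrite /dgauge (EFinM (pi / 4)).
  apply: lee_wpmul2l; first by rewrite lee_fin pi4_ge0.
  by rewrite EFin_expe !expe2; apply: lee_pmul => //; exact: ediam_ge0.
rewrite sumEFin lee_fin sumr_const_nat subn0 -mulrnAr ler_wpM2l ?pi4_ge0//.
rewrite -mulr_natr natrM -nE le_eqVlt; apply/orP; left; apply/eqP.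
by rewrite (_ : 4 * C * M = C * 2 * (2 * M)); [rewrite -wN; ring|lra].
Qed.

Lemma diff2_le (gamma : R * R -> R) (z v : R * R) :
  `|'d gamma z v| <= (`|'d gamma z (1, 0)| + `|'d gamma z (0, 1)|) * `|v|.
Proof.
have -> : 'd gamma z v = v.1 * 'd gamma z (1, 0) + v.2 * 'd gamma z (0, 1).
  rewrite -[v.1 * _]/(v.1 *: _) -[v.2 * _]/(v.2 *: _) -!linearZ -linearD; congr ('d gamma z _).
  apply: injective_projections; rewrite /= ?scaler0 ?addr0 ?add0r.
    by rewrite [RHS]mulr1.
  by rewrite [RHS]mulr1.
apply: le_trans (ler_normD _ _) _; rewrite !normrM mulrDl.
by apply: lerD; rewrite mulrC ler_wpM2l// prod_normE le_max lexx ?orbT.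
Qed.

(** The derivative is Lipschitz, hence bounded on a ball; the mean value theorem
    on segments, which stay in the ball, gives the Lipschitz bound. *)
Lemma C11_locally_lipschitz (gamma : R * R -> R) (M : R) : C11 gamma ->
  exists2 K : R, 0 <= K & forall a b : R * R, `|a| <= M -> `|b| <= M ->
    `|gamma a - gamma b| <= K * `|a - b|.
Proof.
move=> [dg [L Llip]]; pose D0 := 'd gamma 0 : R * R -> R.
pose K := `|D0 (1, 0)| + `|D0 (0, 1)| + `|L| * `|M|.
have K0 : 0 <= K by rewrite !addr_ge0// mulr_ge0.
exists K => // a b aM bM.
have dK z v : `|z| <= M -> `|'d gamma z v| <= K * `|v|.
  move=> zM; rewrite -(subrK (D0 v) ('d gamma z v)).
  apply: le_trans (ler_normD _ _) _; rewrite addrC mulrDl; apply: lerD.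
    exact: diff2_le.
  apply: le_trans (Llip z 0 v) _; rewrite subr0; apply: ler_wpM2r => //.
  apply: (@le_trans _ _ (`|L| * `|z|)); first by rewrite ler_wpM2r ?ler_norm.
  by rewrite ler_wpM2l// (le_trans zM) ?ler_norm.
pose line t : R * R := b + t *: (a - b).
pose g t := gamma (line t).
have gder (t : R) : is_derive t 1 g ('d gamma (line t) (a - b)).
  have h : (fun h : R => h^-1 *: ((g \o shift t) (h *: 1) - g t)) =
    (fun h : R => h^-1 *: ((gamma \o shift (line t)) (h *: (a - b)) - gamma (line t))).
    apply/funext => h; congr (_ *: (gamma _ - _)).
    by rewrite /line /shift/= scaler1 scalerDl addrCA.
  have [dv ev] : is_derive (line t) (a - b) gamma ('d gamma (line t) (a - b)).
    by split; [exact: diff_derivable|rewrite deriveE].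
  by split; [rewrite /derivable h|rewrite -ev /derive h].
have [|t] := @MVT _ g (fun t => 'd gamma (line t) (a - b)) 0 1 ltr01 (fun t _ => gder t).
  by apply: derivable_within_continuous => t _; have [] := gder t.
rewrite in_itv/= => /andP[t0 t1]; rewrite subr0 mulr1.
rewrite {1}/g {1}/g /line scale1r scale0r addr0 subrKC => ->; apply: dK.
have -> : b + t *: (a - b) = (1 - t) *: b + t *: a.
  by rewrite scalerBr scalerBl scale1r -addrA; congr (_ + _); rewrite addrC.
apply: le_trans (ler_normD _ _) _; rewrite !normrZ !gtr0_norm ?subr_gt0//.
have -> : M = (1 - t) * M + t * M by ring.
by apply: lerD; apply: ler_wpM2l => //; rewrite ?subr_ge0 ltW.
Qed.

End graph_area.

(** * Area of a compact boundary of class C^{1,1} *)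

Section enorm_topology.
Context (R : realType).
Implicit Types (x y p : pt R) (A : set (pt R)).

Lemma enorm_distC x y : enorm (x - y) = enorm (y - x).
Proof. by rewrite -opprB -scaleN1r enormZ normrN1 mul1r. Qed.

Lemma nbhs_enormP x A :
  nbhs x A <-> exists2 e, 0 < e & forall y, enorm (x - y) < e -> A y.
Proof.
split=> [/nbhs_ballP[e /= e0 eA]|[e e0 eA]].
  exists e => // y xy; apply: eA; have [h1 h2 h3] := coord_le_enorm (x - y).
  by split; [split|]; apply: le_lt_trans xy.
apply/nbhs_ballP; exists (e / 3) => /=; first by rewrite divr_gt0.
move=> y [[h1 h2] h3]; apply: eA; apply: le_lt_trans (enorm_le_sum _) _.
move: h1 h2 h3; rewrite /ball/= => h1 h2 h3.
by rewrite (_ : e = e / 3 + e / 3 + e / 3); [rewrite !ltrD|field].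
Qed.

Lemma continuous_enorm_lipschitz (f : pt R -> R) :
  (forall x y, `|f x - f y| <= enorm (x - y)) -> continuous f.
Proof.
move=> fl x; apply/cvgrPdist_lt => e e0; apply/nbhs_enormP; exists e => // y.
exact: le_lt_trans.
Qed.

Lemma bd_closed (A : set (pt R)) : closed (bd A).
Proof.
rewrite /bd setDE; apply: closedI; first exact: closed_closure.
exact/open_closedC/open_interior.
Qed.

End enorm_topology.

Section triangle.
Context (R : realType).

Lemma enormD (x y : pt R) : enorm (x + y) <= enorm x + enorm y.
Proof.
rewrite -[leRHS]ger0_norm ?addr_ge0 ?enorm_ge0// -sqrtr_sqr ler_wsqrtr//.
set a := enorm x; set b := enorm y.
have a2 : a ^+ 2 = x.1.1 ^+ 2 + x.1.2 ^+ 2 + x.2 ^+ 2.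
  by rewrite sqr_sqrtr// !addr_ge0 ?sqr_ge0.
have b2 : b ^+ 2 = y.1.1 ^+ 2 + y.1.2 ^+ 2 + y.2 ^+ 2.
  by rewrite sqr_sqrtr// !addr_ge0 ?sqr_ge0.
have ab0 : 0 <= a * b by rewrite mulr_ge0 ?enorm_ge0.
suff cs : x.1.1 * y.1.1 + x.1.2 * y.1.2 + x.2 * y.2 <= a * b.
  rewrite [leRHS]sqrrD a2 b2 /=; lra.
apply: le_trans (ler_norm _) _; rewrite -(ger0_norm ab0) -ler_sqr ?nnegrE// !real_normK ?num_real//.
rewrite exprMn a2 b2 -subr_ge0.
have -> : (x.1.1 ^+ 2 + x.1.2 ^+ 2 + x.2 ^+ 2) * (y.1.1 ^+ 2 + y.1.2 ^+ 2 + y.2 ^+ 2) -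
  (x.1.1 * y.1.1 + x.1.2 * y.1.2 + x.2 * y.2) ^+ 2 =
  (x.1.1 * y.1.2 - x.1.2 * y.1.1) ^+ 2 + (x.1.1 * y.2 - x.2 * y.1.1) ^+ 2 +
  (x.1.2 * y.2 - x.2 * y.1.2) ^+ 2 by ring.
by rewrite !addr_ge0 ?sqr_ge0.
Qed.

Lemma open_enorm_ball p (r : R) : open [set x : pt R | enorm (x - p) < r].
Proof.
rewrite openE => x /= xr; apply/nbhs_enormP; exists (r - enorm (x - p)).
  by rewrite subr_gt0.
move=> y; rewrite ltrBrDr enorm_distC => h; apply: le_lt_trans h.
by rewrite -[y - p](subrKA x) enormD.
Qed.

End triangle.

Section boundary_area.
Context (R : realType).

(** Near [p], the boundary lies on the graph: at a point strictly above or below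
    the graph, continuity keeps a whole neighbourhood inside or outside [A]. Up
    to the isometry, that graph is Lipschitz over a bounded square. *)
Lemma surf_local_boundary_lty (A : set (pt R)) (p : pt R) : C11_boundary A -> bd A p ->
  exists2 r : R, 0 < r & (surf (bd A `&` [set x | enorm (x - p) < r]%R) < +oo)%E.
Proof.
move=> cA /cA[rho [gamma [r [iso gC r0 graph]]]]; exists r => //.
set P := bd A `&` _.
have coord x y : [/\ `|(rho x).1.1 - (rho y).1.1| <= enorm (x - y),
  `|(rho x).1.2 - (rho y).1.2| <= enorm (x - y) & `|(rho x).2 - (rho y).2| <= enorm (x - y)].
  by have := coord_le_enorm (rho x - rho y); rewrite iso.
have c1 : continuous (fun x => (rho x).1.1 : R).
  by apply: continuous_enorm_lipschitz => x y; have [] := coord x y.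
have c2 : continuous (fun x => (rho x).1.2 : R).
  by apply: continuous_enorm_lipschitz => x y; have [] := coord x y.
have c3 : continuous (fun x => (rho x).2 : R).
  by apply: continuous_enorm_lipschitz => x y; have [] := coord x y.
have cg : continuous (fun x => (rho x).2 - gamma ((rho x).1.1 : R, (rho x).1.2 : R) : R).
  have c4 : continuous (fun x => gamma ((rho x).1.1 : R, (rho x).1.2 : R)).
    move=> x; apply: (@continuous_comp _ _ _ (fun x => ((rho x).1.1 : R, (rho x).1.2 : R)) gamma).
      exact: (cvg_pair (c1 x) (c2 x)).
    by apply: differentiable_continuous; apply: gC.1.
  by move=> x; exact: (cvgB (c3 x) (c4 x)).
have graphE x : P x -> (rho x).2 = gamma (rho x).1.
  move=> [[Ax nAx] xp].
  have gE y : gamma (rho y).1 = gamma ((rho y).1.1, (rho y).1.2) by case: (rho y).1.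
  have xpn : nbhs x [set x | enorm (x - p) < r] by apply: open_nbhs_nbhs; split => //; exact: open_enorm_ball.
  apply/eqP; rewrite eq_le; apply/andP; split; rewrite leNgt; apply/negP => lt.
    apply: nAx; rewrite /interior/=.
    have : nbhs x [set y | 0 < (rho y).2 - gamma ((rho y).1.1 : R, (rho y).1.2 : R)].
      by apply: (cvgr_gt _ (cg x)); rewrite subr_gt0 -gE.
    by move=> /filterI/(_ xpn); apply: filterS => y [/= h1 h2]; apply/graph; rewrite // gE -subr_gt0.
  have : nbhs x [set y | (rho y).2 - gamma ((rho y).1.1 : R, (rho y).1.2 : R) < 0].
    by apply: (cvgr_lt _ (cg x)); rewrite subr_lt0 -gE.
  move=> /filterI/(_ xpn)/Ax[y [Ay [/= h1 h2]]].
  by move: Ay => /(graph y h2); rewrite gE -subr_gt0 => /(lt_trans h1); rewrite ltxx.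
pose M := `|(rho p).1.1| + `|(rho p).1.2| + r.
have M0 : 0 < M by rewrite ltr_wpDl// addr_ge0.
have [K K0 Klip] := C11_locally_lipschitz M gC.
have PM x : P x -> `|(rho x).1.1| < M /\ `|(rho x).1.2| < M.
  move=> [_ xp]; have [h1 h2 _] := coord x p; split.
    rewrite -(subrK (rho p).1.1 (rho x).1.1) (le_lt_trans (ler_normD _ _))// /M.
    have := normr_ge0 (rho p).1.2; move: (le_lt_trans h1 xp); lra.
  rewrite -(subrK (rho p).1.2 (rho x).1.2) (le_lt_trans (ler_normD _ _))// /M.
  have := normr_ge0 (rho p).1.1; move: (le_lt_trans h2 xp); lra.
apply: (@surf_graph_lty _ _ (fun x => (rho x).1.1) (fun x => (rho x).1.2) M (1 + K)) => //.
  by rewrite addr_ge0.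
move=> x y Px Py; rewrite -iso.
apply: le_trans (enorm_le_sum _) _; rewrite [leRHS]mulrDl mul1r; apply: lerD => //.
rewrite -[(rho x - rho y).2]/((rho x).2 - (rho y).2) !graphE//.
have nM z : P z -> `|((rho z).1 : R * R)| <= M.
  by move=> /PM[z1 z2]; rewrite prod_normE ge_max !ltW.
apply: le_trans (Klip _ _ (nM _ Px) (nM _ Py)) _; apply: ler_wpM2l => //.
by rewrite prod_normE ge_max lerDl lerDr !normr_ge0.
Qed.

(** Finitely many neighbourhoods as in [surf_local_boundary_lty] cover a compact
    boundary. *)
Lemma surf_boundary_lty (A : set (pt R)) : C11_boundary A ->
  compact (bd A) -> (surf (bd A) < +oo)%E.
Proof.
move=> cA /compact_near_coveringP cov.
(* Compactness is used through filters: F consists of the families of sets that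
   contain all supersets of some set of finite area. The pieces of the boundary
   near each point are eventually, along F, contained in C; hence so is the whole
   boundary, and F contains the family of supersets of the boundary. *)
pose F : set_system (set (pt R)) := [set C | exists2 B, (surf B < +oo)%E &
  forall B', B `<=` B' -> C B'].
have FF : Filter F.
  split.
  - by exists set0 => //; rewrite surf0.
  - move=> P Q [B Boo BP] [C Coo CQ]; exists (B `|` C).
      by apply: le_lt_trans (outer_measureU2 _ _ _) _; exact: lte_add_pinfty.
    by move=> D; rewrite subUset => -[/BP ? /CQ ?].
  - by move=> P Q PQ [B Boo BP]; exists B => // D /BP/PQ.
have [p Ap|B Boo] := cov _ F (fun C x => bd A x -> C x) FF; last first.
  by move=> /(_ B (@subset_refl _ _)) AB; apply: le_lt_trans Boo; apply: le_surf => x Ax; exact: AB.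
have [r r0 h] := surf_local_boundary_lty cA Ap.
exists ([set x | enorm (x - p) < r], [set C | bd A `&` [set x | enorm (x - p) < r] `<=` C]) => /=.
  split; last by exists (bd A `&` [set x | enorm (x - p) < r]%R).
  apply: open_nbhs_nbhs; split; first exact: open_enorm_ball.
  by rewrite /= subrr -(scale0r (p : pt R)) enormZ normr0 mul0r.
by move=> [x C] /= [xp pC] Ax; apply: pC.
Qed.

Lemma compact_in_unit_cube (A : set (pt R)) : closed A -> A `<=` @unit_cube R -> compact A.
Proof.
move=> clA Acube.
have cI : compact (`[0%R, 1%R]%classic : set (measurableTypeR R)) by exact: segment_compact.
apply: (subclosed_compact clA (compact_setX (compact_setX cI cI) cI)).
by move=> x /Acube[h1 h2 h3]; split; [split|]; rewrite /= in_itv/=; apply/andP; split; lra.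
Qed.

End boundary_area.

(** * Averaging does not increase the fractional energy *)

Section mean_value.
Local Open Scope ereal_scope.
Context d (Y : measurableType d) (R : realType) (pr : probability Y R).
Variable f : Y -> R.
Hypothesis mf : measurable_fun setT f.

(** [2 * `|f| <= 1 + f ^+ 2], and constants are integrable. *)
Lemma integrable_of_sqr : \int[pr]_z ((f z) ^+ 2)%:E < +oo ->
  pr.-integrable setT (EFin \o f).
Proof.
move=> foo; apply: (@le_integrable _ _ _ _ _ _ _ (fun z => (1 + f z ^+ 2)%:E)) => //.
- exact/measurable_EFinP.
- move=> z _; rewrite /= lee_fin [leRHS]ger0_norm ?addr_ge0 ?sqr_ge0//.
  rewrite -(real_normK (num_real (f z))).
  have := sqr_ge0 (`|f z| - 1)%R; have := normr_ge0 (f z); nra.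
apply/integrableP; split.
  apply/measurable_EFinP; apply: measurable_funD => //; exact: measurable_funX.
under eq_integral => z _ do rewrite gee0_abs ?lee_fin ?addr_ge0 ?sqr_ge0// EFinD.
rewrite ge0_integralD//; last 2 first.
- by move=> z _; rewrite lee_fin sqr_ge0.
- by apply/measurable_EFinP; exact: measurable_funX.
by rewrite integral_cst// mul1e; apply: lte_add_pinfty => //;
  exact: (le_lt_trans (probability_le1 pr measurableT) (ltry 1)).
Qed.

(** Jensen's inequality for the square: integrate [2 * m * f <= f ^+ 2 + m ^+ 2]
    where [m] is the mean of [f]. When [f ^+ 2] is not integrable, the right-hand
    side is [+oo], whatever the value given to the mean. *)
Lemma sqr_Rintegral_le :
  ((\int[pr]_z f z)%R ^+ 2)%:E <= \int[pr]_z ((f z) ^+ 2)%:E.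
Proof.
have [foo|] := ltP (\int[pr]_z ((f z) ^+ 2)%:E) +oo; last first.
  by rewrite leye_eq => /eqP ->; exact: leey.
have fint := integrable_of_sqr foo.
set m := (\int[pr]_z f z)%R.
have mE : \int[pr]_z (f z)%:E = m%:E by rewrite /m /Rintegral fineK//; exact: integrable_fin_num.
have f2int : pr.-integrable setT (fun z => (f z ^+ 2)%:E).
  apply/integrableP; split; first by apply/measurable_EFinP; exact: measurable_funX.
  by under eq_integral => z _ do rewrite gee0_abs ?lee_fin ?sqr_ge0//.
have cint (c : R) : pr.-integrable setT (EFin \o cst c).
  exact: finite_measure_integrable_cst.
have : \int[pr]_z ((2 * m) * f z)%:E <= \int[pr]_z (f z ^+ 2 + m ^+ 2)%:E.
  apply: le_integral => //.
  - by under eq_fun do rewrite EFinM; exact: integrableZl.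
  - by under eq_fun do rewrite EFinD; apply: integrableD => //; exact: cint.
  - by move=> z _; rewrite lee_fin; have := sqr_ge0 (f z - m)%R; nra.
under eq_integral do rewrite EFinM.
rewrite integralZl// mE.
under [leRHS]eq_integral do rewrite EFinD.
rewrite integralD//; last exact: cint.
rewrite [X in _ <= _ + X](_ : _ = (m ^+ 2)%:E); last first.
  rewrite (integral_cst pr measurableT) -[RHS]mule1; congr (_ * _).
  exact: probability_setT.
rewrite -EFinM -leeBlDr//.
by rewrite -EFinB (_ : (2 * m * m - m ^+ 2 = m ^+ 2)%R)//; ring.
Qed.

End mean_value.

Section energy.
Local Open Scope ereal_scope.
Context d (T : measurableType d) (R : realType).
Variable sigma : {finite_measure set T -> \bar R}.
Variable K : T * T -> R.
Hypothesis mK : measurable_fun setT K.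
Hypothesis K0 : forall p, (0 <= K p)%R.
Implicit Types v w : T -> R.

(** For surface measure on [G] and [K (x, y) = `|x - y| `^ (- (2 + 2 * al))], this
    is the square of the norm of [H^al(G)]. *)
Definition energy v : \bar R :=
  \int[sigma]_x ((v x) ^+ 2)%:E +
  \int[sigma]_x \int[sigma]_y ((v x - v y) ^+ 2 * K (x, y))%:E.

Lemma measurable_sqr v : measurable_fun setT v ->
  measurable_fun setT (fun x => ((v x) ^+ 2)%:E).
Proof. by move=> mv; apply/measurable_EFinP; exact: measurable_funX. Qed.

Lemma measurable_increment v : measurable_fun setT v ->
  measurable_fun setT (fun p : T * T => ((v p.1 - v p.2) ^+ 2 * K p)%:E).
Proof.
move=> mv; apply/measurable_EFinP; apply: measurable_funM => //.
apply: measurable_funX; apply: measurable_funB;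
  [exact: (measurableT_comp mv measurable_fst)|exact: (measurableT_comp mv measurable_snd)].
Qed.

Lemma increment_ge0 v x y : 0 <= ((v x - v y) ^+ 2 * K (x, y))%:E.
Proof. by rewrite lee_fin mulr_ge0 ?sqr_ge0. Qed.

Lemma measurable_increment_integral v : measurable_fun setT v ->
  measurable_fun setT (fun x => \int[sigma]_y ((v x - v y) ^+ 2 * K (x, y))%:E).
Proof.
move=> mv.
apply: (@measurable_fun_fubini_tonelli_F _ _ _ _ _ sigma _ (measurable_increment mv)).
by move=> p; rewrite lee_fin mulr_ge0 ?sqr_ge0.
Qed.

Lemma energy_ge0 v : 0 <= energy v.
Proof.
apply: adde_ge0; apply: integral_ge0 => x _; first by rewrite lee_fin sqr_ge0.
by apply: integral_ge0 => y _; exact: increment_ge0.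
Qed.

Lemma energy_ae_eq v w : measurable_fun setT v -> measurable_fun setT w ->
  {ae sigma, forall x, v x = w x} -> energy v = energy w.
Proof.
move=> mv mw vw; congr (_ + _).
  apply: ge0_ae_eq_integral => //; try exact: measurable_sqr;
    try (by move=> x _; rewrite lee_fin sqr_ge0).
  by apply: filterS vw => x e _; rewrite e.
apply: ge0_ae_eq_integral => //; try exact: measurable_increment_integral;
  try (by move=> x _; apply: integral_ge0 => y _; exact: increment_ge0).
apply: filterS (vw) => x e _.
apply: ge0_ae_eq_integral => //; try (by move=> y _; exact: increment_ge0).
- exact: (measurable_fun_pair2 x (measurable_increment mv)).
- exact: (measurable_fun_pair2 x (measurable_increment mw)).
- by apply: filterS vw => y e' _; rewrite e e'.
Qed.

Lemma energyZ (a : R) v : measurable_fun setT v ->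
  energy (fun x => a * v x)%R = (a ^+ 2)%:E * energy v.
Proof.
move=> mv; rewrite /energy ge0_muleDr; last 2 first.
- by apply: integral_ge0 => x _; rewrite lee_fin sqr_ge0.
- by apply: integral_ge0 => x _; apply: integral_ge0 => y _; exact: increment_ge0.
congr (_ + _).
  under eq_integral do rewrite exprMn EFinM.
  rewrite ge0_integralZl ?lee_fin ?sqr_ge0//; first exact: measurable_sqr.
  by move=> x _; rewrite lee_fin sqr_ge0.
rewrite -ge0_integralZl ?lee_fin ?sqr_ge0//; last 2 first.
- exact: measurable_increment_integral.
- by move=> x _; apply: integral_ge0 => y _; exact: increment_ge0.
apply: eq_integral => x _.
under eq_integral do rewrite -mulrBr exprMn -mulrA EFinM.
rewrite ge0_integralZl ?lee_fin ?sqr_ge0//.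
- exact: (measurable_fun_pair2 x (measurable_increment mv)).
- by move=> y _; exact: increment_ge0.
Qed.

Section average.
Context d' (Y : measurableType d') (pr : probability Y R).
Variable Phi : Y * T -> R.
Hypothesis mPhi : measurable_fun setT Phi.

Definition average (y : T) : R := (\int[pr]_z Phi (z, y))%R.

Lemma measurable_average : measurable_fun setT average.
Proof.
have mP := @measurable_fun_fubini_tonelli_G _ _ _ _ _ pr.
apply: (measurableT_comp (f := fine)) => //.
have -> : (fun y => \int[pr]_z (Phi (z, y))%:E) =
  (fun y => \int[pr]_z ((fun p => (Phi p)%:E)^\+ (z, y)) - \int[pr]_z ((fun p => (Phi p)%:E)^\- (z, y))).
  apply/funext => y; rewrite integralE; congr (_ - _);
  by apply: eq_integral => z _; rewrite ?funeposE ?funenegE.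
have mE : measurable_fun setT (fun p => (Phi p)%:E) by exact/measurable_EFinP.
apply: emeasurable_funB => //.
- exact: (mP _ _ _ (measurable_funepos mE) (fun p => funepos_ge0 _ p)).
- exact: (mP _ _ _ (measurable_funeneg mE) (fun p => funeneg_ge0 _ p)).
Qed.

Hypothesis Phi_fin : \int[pr]_z energy (fun y => Phi (z, y)) < +oo.

Let mPhi2 : measurable_fun setT (fun p => ((Phi p) ^+ 2)%:E).
Proof. by apply/measurable_EFinP; exact: measurable_funX. Qed.

Let mIncr : measurable_fun setT (fun p : (Y * T) * T => ((Phi p.1 - Phi (p.1.1, p.2)) ^+ 2 * K (p.1.2, p.2))%:E).
Proof.
apply/measurable_EFinP; apply: measurable_funM.
  apply: measurable_funX; apply: measurable_funB.
    exact: (measurableT_comp mPhi measurable_fst).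
  apply: (measurableT_comp mPhi); apply: measurable_fun_pair => //.
  exact: measurableT_comp.
apply: (measurableT_comp mK); apply: measurable_fun_pair => //.
exact: measurableT_comp.
Qed.

Let Incr_ge0 (p : (Y * T) * T) : 0 <= ((Phi p.1 - Phi (p.1.1, p.2)) ^+ 2 * K (p.1.2, p.2))%:E.
Proof. by rewrite lee_fin mulr_ge0 ?sqr_ge0. Qed.

Let mslice z : measurable_fun setT (fun y => Phi (z, y)).
Proof. exact: measurable_fun_pair2. Qed.

Let mIncr_y := @measurable_fun_fubini_tonelli_F _ _ _ _ _ sigma _ mIncr Incr_ge0.

Lemma measurable_energy_slice :
  measurable_fun setT (fun z => energy (fun y => Phi (z, y))).
Proof.
apply: emeasurable_funD.
  by apply: (measurable_fun_fubini_tonelli_F _ mPhi2) => p; rewrite lee_fin sqr_ge0.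
apply: (measurable_fun_fubini_tonelli_F _ mIncr_y) => p.
by apply: integral_ge0 => y _; exact: Incr_ge0.
Qed.

Let integral_energyE : \int[pr]_z energy (fun y => Phi (z, y)) =
  \int[pr]_z \int[sigma]_y ((Phi (z, y)) ^+ 2)%:E +
  \int[pr]_z \int[sigma]_x \int[sigma]_y ((Phi (z, x) - Phi (z, y)) ^+ 2 * K (x, y))%:E.
Proof.
rewrite ge0_integralD//.
- by move=> z _; apply: integral_ge0 => y _; rewrite lee_fin sqr_ge0.
- by apply: (measurable_fun_fubini_tonelli_F _ mPhi2) => p; rewrite lee_fin sqr_ge0.
- by move=> z _; apply: integral_ge0 => x _; apply: integral_ge0 => y _; rewrite lee_fin mulr_ge0 ?sqr_ge0.
- apply: (measurable_fun_fubini_tonelli_F _ mIncr_y) => p.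
  by apply: integral_ge0 => y _; rewrite lee_fin mulr_ge0 ?sqr_ge0.
Qed.

(** For the remaining [y] the mean is a default value, unrelated to the slices. *)
Lemma ae_integrable_slice :
  {ae sigma, forall y, pr.-integrable setT (fun z => (Phi (z, y))%:E)}.
Proof.
have h : \int[sigma]_y \int[pr]_z ((Phi (z, y)) ^+ 2)%:E < +oo.
  rewrite -(fubini_tonelli (fun p => ((Phi p) ^+ 2)%:E))//; last by move=> p; rewrite lee_fin sqr_ge0.
  apply: le_lt_trans Phi_fin; rewrite integral_energyE leeDl//.
  apply: integral_ge0 => z _; apply: integral_ge0 => x _; apply: integral_ge0 => y _.
  by rewrite lee_fin mulr_ge0 ?sqr_ge0.
have mG : measurable_fun setT (fun y => \int[pr]_z ((Phi (z, y)) ^+ 2)%:E).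
  apply: (@measurable_fun_fubini_tonelli_G _ _ _ _ _ pr (fun p => ((Phi p) ^+ 2)%:E)) => //.
  by move=> p; rewrite lee_fin sqr_ge0.
have G0 y : 0 <= \int[pr]_z ((Phi (z, y)) ^+ 2)%:E.
  by apply: integral_ge0 => z _; rewrite lee_fin sqr_ge0.
have /integrable_ae : sigma.-integrable setT (fun y => \int[pr]_z ((Phi (z, y)) ^+ 2)%:E).
  by apply/integrableP; split => //; under eq_integral do rewrite gee0_abs//.
move=> /(_ measurableT); apply: filterS => y /(_ Logic.I); rewrite ge0_fin_numE// => hy.
apply: (integrable_of_sqr _ hy).
exact: measurable_fun_pair1.
Qed.

(** Tonelli's theorem puts the integral over [Y] innermost. There the integrands
    are the squares of [Phi (z, x)] and of [Phi (z, x) - Phi (z, y)], and Jensen's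
    inequality applies. Linearity of the mean in the increments needs integrable
    slices, hence the bounds almost everywhere. *)
Lemma energy_average_le : energy average <= \int[pr]_z energy (fun y => Phi (z, y)).
Proof.
rewrite integral_energyE; apply: leeD.
  rewrite (fubini_tonelli (fun p => ((Phi p) ^+ 2)%:E))//; last by move=> p; rewrite lee_fin sqr_ge0.
  apply: ge0_le_integral => //.
  - by move=> y _; rewrite lee_fin sqr_ge0.
  - by apply: measurable_sqr; exact: measurable_average.
  - apply: (@measurable_fun_fubini_tonelli_G _ _ _ _ _ pr (fun p => ((Phi p) ^+ 2)%:E)) => //.
    by move=> p; rewrite lee_fin sqr_ge0.
  - by move=> y _; apply: sqr_Rintegral_le; exact: measurable_fun_pair1.
rewrite (fubini_tonelli (fun p : Y * T => \int[sigma]_y ((Phi p - Phi (p.1, y)) ^+ 2 * K (p.2, y))%:E) mIncr_y); last first.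
  by move=> p; apply: integral_ge0 => y _; rewrite lee_fin mulr_ge0 ?sqr_ge0.
have mG := @measurable_fun_fubini_tonelli_G _ _ _ _ _ pr (fun p : Y * T => \int[sigma]_y ((Phi p - Phi (p.1, y)) ^+ 2 * K (p.2, y))%:E) mIncr_y.
apply: ae_ge0_le_integral => //.
- by move=> x _; apply: integral_ge0 => y _; exact: increment_ge0.
- by apply: measurable_increment_integral; exact: measurable_average.
- by move=> x _; apply: integral_ge0 => z _; apply: integral_ge0 => y _; rewrite lee_fin mulr_ge0 ?sqr_ge0.
- by apply: mG => p; apply: integral_ge0 => y _; rewrite lee_fin mulr_ge0 ?sqr_ge0.
apply: filterS (ae_integrable_slice) => x gx _.
have mxyz : measurable_fun setT (fun p : Y * T => ((Phi (p.1, x) - Phi p) ^+ 2 * K (x, p.2))%:E).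
  apply/measurable_EFinP; apply: measurable_funM.
    apply: measurable_funX; apply: measurable_funB => //.
    by apply: (measurableT_comp mPhi); apply: measurable_fun_pair.
  by apply: (measurableT_comp mK); apply: measurable_fun_pair.
have xyz0 (p : Y * T) : 0 <= ((Phi (p.1, x) - Phi p) ^+ 2 * K (x, p.2))%:E.
  by rewrite lee_fin mulr_ge0 ?sqr_ge0.
rewrite (fubini_tonelli (fun p : Y * T => ((Phi (p.1, x) - Phi p) ^+ 2 * K (x, p.2))%:E))//.
apply: ae_ge0_le_integral => //.
- by move=> y _; exact: increment_ge0.
- exact: (measurable_fun_pair2 x (measurable_increment measurable_average)).
- by move=> y _; apply: integral_ge0 => z _; rewrite lee_fin mulr_ge0 ?sqr_ge0.
- exact: (@measurable_fun_fubini_tonelli_G _ _ _ _ _ pr _ mxyz xyz0).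
apply: filterS (ae_integrable_slice) => y gy _ /=.
have mz : measurable_fun setT (fun z => Phi (z, x) - Phi (z, y))%R.
  by apply: measurable_funB; exact: measurable_fun_pair1.
under eq_integral do rewrite EFinM.
rewrite ge0_integralZr//; last 3 first.
- by apply/measurable_EFinP; exact: measurable_funX.
- by move=> z _; rewrite lee_fin sqr_ge0.
- by rewrite lee_fin.
rewrite EFinM; apply: lee_wpmul2r; first by rewrite lee_fin.
have -> : (average x - average y = \int[pr]_z (Phi (z, x) - Phi (z, y)))%R.
  by rewrite /average -RintegralB.
exact: sqr_Rintegral_le.
Qed.

End average.

End energy.

(** * Geometry of the cells *)

Section cell_geometry.
Context (R : realType) (eps : R) (eps0 : 0 < eps).
Implicit Types (xi : int * int * int) (G Om : set (pt R)) (x y : pt R).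

Definition cell_map xi : pt R -> pt R := affine (eps *: zvec R xi) eps.

Lemma floor_int_add (n : int) (t : R) : 0 <= t < 1 -> Num.floor (n%:~R + t) = n.
Proof.
move=> t01; apply: floor_def; rewrite -[n + 1]addrC rmorphD/=; lra.
Qed.

Lemma scale_cell_map xi y : eps^-1 *: cell_map xi y = zvec R xi + y.
Proof. by rewrite /cell_map /affine -scalerDr scalerA mulVf ?gt_eqF// scale1r. Qed.

Lemma ipart_cell_map xi y : unit_cube y -> ipart (eps^-1 *: cell_map xi y) = zvec R xi.
Proof.
move=> [y1 y2 y3]; rewrite scale_cell_map /ipart /zvec /=.
by rewrite !floor_int_add//; lra.
Qed.

Lemma fpart_cell_map xi y : unit_cube y -> fpart (eps^-1 *: cell_map xi y) = y.
Proof.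
by move=> cy; rewrite /fpart ipart_cell_map// scale_cell_map addrC addKr.
Qed.

Lemma zvec_inj : injective (@zvec R).
Proof.
move=> [[a b] c] [[a' b'] c'] [] /eqP + /eqP + /eqP.
by rewrite !eqr_int => /eqP -> /eqP -> /eqP ->.
Qed.

Lemma cell_map_inj2 xi xi' y y' : unit_cube y -> unit_cube y' ->
  cell_map xi y = cell_map xi' y' -> xi = xi'.
Proof.
move=> cy cy' e; apply: zvec_inj.
by rewrite -(ipart_cell_map xi cy) e ipart_cell_map.
Qed.

Lemma trivIset_cell (D : set (int * int * int)) G : G `<=` @unit_cube R ->
  trivIset D (fun xi => cell eps xi G).
Proof.
move=> Gc xi xi' _ _ [_ [[y Gy <-] [y' Gy' e]]].
by apply: (cell_map_inj2 (Gc _ Gy) (Gc _ Gy')); exact/esym.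
Qed.

Lemma closure_unit_cube x : closure (@unit_cube R) x ->
  [/\ 0 <= x.1.1 <= 1, 0 <= x.1.2 <= 1 & 0 <= x.2 <= 1].
Proof.
move=> cx.
have near e : 0 < e -> exists2 z, unit_cube z & enorm (x - z) < e.
  move=> e0; have /cx[z [cz xz]] : nbhs x [set z | enorm (x - z) < e].
    by apply/nbhs_enormP; exists e.
  by exists z.
have coord (f : pt R -> R) : (forall z, unit_cube z -> 0 < f z < 1) ->
    (forall x y, `|f x - f y| <= enorm (x - y)) -> 0 <= f x <= 1.
  move=> fc fl; apply/andP; split; apply/ler_addgt0Pr => e e0;
    have [z /fc/andP[z1 z2] /(le_lt_trans (fl x z))] := near e e0;
    rewrite ltr_norml => /andP[h1 h2]; lra.
have fl (z z' : pt R) := coord_le_enorm (z - z').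
split; [apply: (coord (fun x => x.1.1))|apply: (coord (fun x => x.1.2))|apply: (coord (fun x => x.2))];
  try (by move=> z []); by move=> z z'; have [] := fl z z'.
Qed.

Lemma nbhs_unit_cube x : unit_cube x -> nbhs x (@unit_cube R).
Proof.
move=> [/andP[a1 a2] /andP[b1 b2] /andP[c1 c2]]; apply/nbhs_enormP.
exists (Num.min (Num.min (Num.min x.1.1 (1 - x.1.1)) (Num.min x.1.2 (1 - x.1.2))) (Num.min x.2 (1 - x.2))).
  by rewrite !lt_min; do ?[apply/andP; split]; lra.
move=> y; rewrite !lt_min => /andP[/andP[/andP[h1 h2] /andP[h3 h4]] /andP[h5 h6]].
have [k1 k2 k3] := coord_le_enorm (x - y).
move: k1 k2 k3; rewrite /= !ler_norml => /andP[k1 k1'] /andP[k2 k2'] /andP[k3 k3'].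
by split; apply/andP; split; lra.
Qed.

Lemma nbhs_cell xi x : cell eps xi (@unit_cube R) x -> nbhs x (cell eps xi (@unit_cube R)).
Proof.
move=> [y cy <-]; have /nbhs_enormP[e e0 ye] := nbhs_unit_cube cy.
apply/nbhs_enormP; exists (eps * e); first by rewrite mulr_gt0.
move=> z; rewrite -/(affine (eps *: zvec R xi) eps y) -/(cell_map xi y) => xz.
exists (affine_inv (eps *: zvec R xi) eps z); last exact: affine_invK.
apply: ye; rewrite -(ltr_pM2l eps0) -{1}(gtr0_norm eps0) -enormZ scalerBr.
have -> : eps *: affine_inv (eps *: zvec R xi) eps z = z - eps *: zvec R xi.
  by rewrite /affine_inv scalerA mulfV ?gt_eqF// scale1r.
by rewrite opprB addrA [eps *: y + _]addrC.
Qed.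

(** On [S_eps] the fractional part of [eps^-1 *: x] lies in the open cube, so no
    coordinate is an integer and the closed cell containing [x] is determined.
    Conversely the open cells are contained in the interior [Omhat]. *)
Lemma cell_unionE Om G : G `<=` @unit_cube R ->
  cell_union Om eps G = \bigcup_(xi in Xi Om eps) cell eps xi G.
Proof.
move=> Gc; apply/seteqP; split => [x [Omx Gx]|x [xi Xxi [y Gy <-]]].
  have [xi Xxi [y /closure_unit_cube[y1 y2 y3] xE]] := nbhs_singleton Omx.
  exists xi => //.
  suff fy : fpart (eps^-1 *: x) = y by exists y => //; rewrite -fy.
  move: (Gc _ Gx); rewrite -xE -[eps *: _ + _]/(cell_map xi y) /fpart scale_cell_map.
  (* the value t = 1 is excluded because the fractional part would then vanish *)
  have floor_coord (n : int) (t : R) : 0 <= t <= 1 ->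
      0 < n%:~R + t - (Num.floor (n%:~R + t))%:~R < 1 -> (Num.floor (n%:~R + t))%:~R = n%:~R :> R.
    move=> /andP[t0 t1] h; have [t1'|t1'] := ltP t 1; first by rewrite floor_int_add// t0.
    have te : t = 1 by apply/eqP; rewrite eq_le t1.
    by move: h; rewrite te -[1]/(1%:~R) -rmorphD/= intrKfloor subrr ltxx.
  move=> [/= h1 h2 h3].
  apply: injective_projections; [apply: injective_projections|];
    by rewrite /= (floor_coord _ _ _ _)// addrC addKr.
split; last by rewrite /= -[eps *: _ + _]/(cell_map xi y) fpart_cell_map//; exact: Gc.
apply: filterS (nbhs_cell (x := cell_map xi y) (xi := xi) _); last by exists y => //; exact: Gc.
move=> z [w cw <-]; exists xi => //; exists w => //; exact: subset_closure.
Qed.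

Lemma finite_Xi Om : bounded_set Om -> finite_set (Xi Om eps).
Proof.
move=> Omb; have [M M0 OmM] : exists2 M, M > 0 & Om `<=` [set x | `|x| < M].
  exact: ex_strict_bound_gt0 Omb.
have [B hB] : exists B : nat, M / eps + 1 < B%:R.
  by exists (Num.truncn (M / eps + 1)).+1; exact: truncnS_gt.
pose I : set int := [set (k%:Z - B%:Z)%R | k in `I_(B + B)].
apply: (@sub_finite_set _ _ ((I `*` I) `*` I)); last first.
  by do ?apply: finite_setX; apply: finite_image; exact: finite_II.
move=> xi Xxi.
have cc : @unit_cube R (2^-1, 2^-1, 2^-1) by split; rewrite /=; lra.
have := OmM _ (Xxi _ (ex_intro2 _ _ _ cc erefl)).
rewrite /= !prod_normE/= !gt_max => /andP[/andP[h1 h2] h3].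
have bnd (n : int) : `|eps * n%:~R + eps * 2^-1| < M -> I n.
  rewrite -mulrDr normrM gtr0_norm// mulrC -ltr_pdivlMr// ltr_norml => /andP[k1 k2].
  have l1 : - B%:Z <= n.
    rewrite -(ler_int R) mulrNz; lra.
  have l2 : n < B%:Z.
    rewrite -(ltr_int R); move: hB; rewrite -pmulrn; lra.
  exists (absz (n + B%:Z)); last by rewrite gez0_abs; lia.
  by rewrite /=; lia.
by split; [split|]; apply: bnd.
Qed.

End cell_geometry.

(** * Fractional norms as energies, and their scaling on one cell *)

Section surface_measure_on.
Local Open Scope ereal_scope.
Context (R : realType).
Implicit Types (al : R) (v : pt R -> R).

(** The area restricted to [G], as a measure on the whole space: the finiteness of
    [surf G] makes it finite, as Tonelli's theorem requires. *)
Definition surf_on (G : set (pt R)) (mG : measurable G) (Gfin : surf G < +oo) :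
  set (pt R) -> \bar R := mrestr (@surf R) mG.

HB.instance Definition _ G mG Gfin := Measure.on (@surf_on G mG Gfin).

Let surf_on_fin G mG Gfin : fin_num_fun (@surf_on G mG Gfin).
Proof.
move=> A mA; rewrite ge0_fin_numE ?measure_ge0//; apply: (le_lt_trans _ Gfin).
by apply: le_surf => x [].
Qed.

HB.instance Definition _ G mG Gfin :=
  @Measure_isFinite.Build _ _ _ (@surf_on G mG Gfin) (surf_on_fin mG Gfin).

Definition riesz (al : R) (p : pt R * pt R) : R :=
  ((enorm (p.1 - p.2)%R `^ (2 + 2 * al))^-1)%R.

Lemma riesz_ge0 al p : (0 <= riesz al p)%R.
Proof. by rewrite invr_ge0 powR_ge0. Qed.

Lemma measurable_enorm : measurable_fun setT (@enorm R).
Proof.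
have msqrt : measurable_fun setT (@Num.sqrt R).
  by apply: continuous_measurable_fun => x; exact: sqrt_continuous.
apply: (measurableT_comp msqrt); apply: measurable_funD; [apply: measurable_funD|];
  apply: measurable_funX;
  [exact: measurable_coord1|exact: measurable_coord2|exact: measurable_coord3].
Qed.

Lemma measurable_riesz al : measurable_fun setT (riesz al).
Proof.
have -> : riesz al = (fun p => enorm (p.1 - p.2)%R `^ (- (2 + 2 * al)))%R.
  by apply/funext => p; rewrite powRN.
apply: (measurableT_comp (@measurable_powR R _)).
apply: (measurableT_comp measurable_enorm).
have c (f : pt R -> R) : measurable_fun setT f ->
    measurable_fun setT (fun p : pt R * pt R => f p.1 - f p.2)%R.
  by move=> mf; apply: measurable_funB; exact: measurableT_comp.
apply: measurable_fun_pair; [apply: measurable_fun_pair|].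
- exact: (c _ (@measurable_coord1 R)).
- exact: (c _ (@measurable_coord2 R)).
- exact: (c _ (@measurable_coord3 R)).
Qed.

Lemma gagliardoE al G v : gagliardo al G v =
  \int[@surf R]_(x in G) \int[@surf R]_(y in G) ((v x - v y) ^+ 2 * riesz al (x, y))%:E.
Proof. by []. Qed.

Lemma integral_surf_on (G : set (pt R)) (mG : measurable G) (Gfin : surf G < +oo) (f : pt R -> \bar R) :
  measurable_fun setT f -> (forall x, 0 <= f x) ->
  \int[surf_on mG Gfin]_x f x = \int[@surf R]_(x in G) f x.
Proof. exact: ge0_integral_mrestr. Qed.

Lemma integral_increment_surf_on al (G : set (pt R)) (mG : measurable G) (Gfin : surf G < +oo) v x :
  measurable_fun setT v ->
  \int[surf_on mG Gfin]_y ((v x - v y) ^+ 2 * riesz al (x, y))%:E =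
  \int[@surf R]_(y in G) ((v x - v y) ^+ 2 * riesz al (x, y))%:E.
Proof.
move=> mv; apply: integral_surf_on.
- exact: (measurable_fun_pair2 x (measurable_increment (measurable_riesz al) mv)).
- by move=> y; rewrite lee_fin mulr_ge0 ?sqr_ge0 ?riesz_ge0.
Qed.

Lemma measurable_gagliardo_inner al (G : set (pt R)) (mG : measurable G) (Gfin : surf G < +oo) v :
  measurable_fun setT v ->
  measurable_fun setT (fun x => \int[@surf R]_(y in G) ((v x - v y) ^+ 2 * riesz al (x, y))%:E).
Proof.
move=> mv.
have -> : (fun x => \int[@surf R]_(y in G) ((v x - v y) ^+ 2 * riesz al (x, y))%:E) =
  (fun x => \int[surf_on mG Gfin]_y ((v x - v y) ^+ 2 * riesz al (x, y))%:E).
  by apply/funext => x; rewrite integral_increment_surf_on.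
exact: (measurable_increment_integral (surf_on mG Gfin) (measurable_riesz al) (riesz_ge0 al) mv).
Qed.

Lemma energy_surf_on al (G : set (pt R)) (mG : measurable G) (Gfin : surf G < +oo) v :
  measurable_fun setT v ->
  L2sq G v + gagliardo al G v = energy (surf_on mG Gfin) (riesz al) v.
Proof.
move=> mv.
have i0 x : 0 <= \int[@surf R]_(y in G) ((v x - v y) ^+ 2 * riesz al (x, y))%:E.
  by apply: integral_ge0 => y _; rewrite lee_fin mulr_ge0 ?sqr_ge0 ?riesz_ge0.
have e1 : \int[@surf R]_(x in G) ((v x) ^+ 2)%:E = \int[surf_on mG Gfin]_x ((v x) ^+ 2)%:E.
  apply/esym/integral_surf_on; first exact: measurable_sqr.
  by move=> x; rewrite lee_fin sqr_ge0.
pose F x := \int[@surf R]_(y in G) ((v x - v y) ^+ 2 * riesz al (x, y))%:E.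
have mF : measurable_fun setT F := measurable_gagliardo_inner al mG Gfin mv.
have e2 : gagliardo al G v =
    \int[surf_on mG Gfin]_x \int[surf_on mG Gfin]_y ((v x - v y) ^+ 2 * riesz al (x, y))%:E.
  rewrite gagliardoE -[LHS]/(\int[@surf R]_(x in G) F x) -(integral_surf_on mG Gfin mF i0).
  by apply: eq_integral => x _; rewrite /F -(integral_increment_surf_on al mG Gfin x mv).
by rewrite /energy -e1 -e2.
Qed.

Lemma energy_surf_on_le al (G S : set (pt R)) (mG : measurable G) (Gfin : surf G < +oo)
    (mS : measurable S) (Sfin : surf S < +oo) v : S `<=` G ->
  measurable_fun setT v ->
  energy (surf_on mS Sfin) (riesz al) v <= energy (surf_on mG Gfin) (riesz al) v.
Proof.
move=> SG mv.
rewrite -(energy_surf_on al mS Sfin mv) -(energy_surf_on al mG Gfin mv) !gagliardoE.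
have i0 A x : 0 <= \int[@surf R]_(y in A) ((v x - v y) ^+ 2 * riesz al (x, y))%:E.
  by apply: integral_ge0 => y _; rewrite lee_fin mulr_ge0 ?sqr_ge0 ?riesz_ge0.
have mFS := measurable_gagliardo_inner al mS Sfin mv.
have mFG := measurable_gagliardo_inner al mG Gfin mv.
apply: leeD.
  apply: ge0_subset_integral => //; first by apply: measurable_funTS; exact: measurable_sqr.
  by move=> x _; rewrite lee_fin sqr_ge0.
apply: (@le_trans _ _ (\int[@surf R]_(x in S) \int[@surf R]_(y in G) ((v x - v y) ^+ 2 * riesz al (x, y))%:E)).
  apply: ge0_le_integral => //; [exact: measurable_funTS|exact: measurable_funTS|].
  move=> x _; apply: ge0_subset_integral => //.
    by apply: measurable_funTS; exact: (measurable_fun_pair2 x (measurable_increment (measurable_riesz al) mv)).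
  by move=> y _; rewrite lee_fin mulr_ge0 ?sqr_ge0 ?riesz_ge0.
by apply: ge0_subset_integral => //; exact: measurable_funTS.
Qed.

End surface_measure_on.

Section cell_scaling.
Local Open Scope ereal_scope.
Context (R : realType) (eps : R) (eps0 : (0 < eps)%R) (al : R).
Context (G : set (pt R)) (mG : measurable G) (Gfin : surf G < +oo).
Implicit Types (w : pt R -> R).
Local Notation tau := (cell_map eps).

Lemma measurable_cell xi : measurable (cell eps xi G).
Proof. exact: measurable_image_affine. Qed.

Lemma surf_cell_lty xi : surf (cell eps xi G) < +oo.
Proof. by rewrite [surf _]surf_affine// lte_mul_pinfty ?lee_fin ?sqr_ge0. Qed.

Lemma measurable_cell_map xi : measurable_fun setT (tau xi).
Proof. exact: measurable_affine. Qed.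

Lemma surf_integral_cell xi (f : pt R -> \bar R) : measurable_fun setT f ->
  (forall x, 0 <= f x) ->
  \int[@surf R]_(x in cell eps xi G) f x =
  (eps ^+ 2)%:E * \int[@surf R]_(x in G) f (tau xi x).
Proof.
move=> mf f0; apply: surf_integral_affine => //; exact: measurable_funTS.
Qed.

Lemma surf_integral_cell_scaled xi (c : R) (f f' : pt R -> \bar R) :
  (0 <= c)%R -> measurable_fun setT f -> measurable_fun setT f' ->
  (forall x, 0 <= f x) -> (forall x, 0 <= f' x) ->
  (forall x, f (tau xi x) = c%:E * f' x) ->
  \int[@surf R]_(x in cell eps xi G) f x =
  (eps ^+ 2 * c)%:E * \int[@surf R]_(x in G) f' x.
Proof.
move=> c0 mf mf' f0 f'0 ff'; rewrite surf_integral_cell// [in RHS](EFinM (eps ^+ 2)) -muleA.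
congr (_ * _).
transitivity (\int[@surf R]_(x in G) (c%:E * f' x)).
  by apply: eq_integral => x _; exact: ff'.
by apply: ge0_integralZl_EFin => //; exact: measurable_funTS.
Qed.

Lemma L2sq_cell xi w : measurable_fun setT w ->
  L2sq (cell eps xi G) w = (eps ^+ 2)%:E * L2sq G (w \o tau xi).
Proof.
move=> mw; apply: (surf_integral_cell xi (measurable_sqr mw)) => x.
by rewrite lee_fin sqr_ge0.
Qed.

Lemma riesz_cell_map xi x y :
  riesz al (tau xi x, tau xi y) = (eps `^ (- (2 + 2 * al)) * riesz al (x, y))%R.
Proof.
rewrite /riesz /= (_ : tau xi x - tau xi y = eps *: (x - y))%R; last first.
  by rewrite /cell_map /affine opprD addrACA subrr add0r scalerBr.
by rewrite enormZ gtr0_norm// powRM ?enorm_ge0// ?(ltW eps0)// invfM powRN.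
Qed.

(** Each of the two integrals contributes [eps ^+ 2] and the kernel contributes
    [eps `^ (- (2 + 2 * al))]; the weight [eps `^ (2 * al)] is the one that makes
    the double integral scale like the square of the L^2 norm. *)
Lemma gagliardo_cell xi w : measurable_fun setT w ->
  (eps `^ (2 * al))%:E * gagliardo al (cell eps xi G) w =
  (eps ^+ 2)%:E * gagliardo al G (w \o tau xi).
Proof.
move=> mw; rewrite !gagliardoE.
have mwt : measurable_fun setT (w \o tau xi).
  by apply: measurableT_comp => //; exact: measurable_cell_map.
have mc := measurable_cell xi; have cfin := surf_cell_lty xi.
have incr0 v x y : 0 <= ((v x - v y) ^+ 2 * riesz al (x, y))%:E.
  by rewrite lee_fin mulr_ge0 ?sqr_ge0 ?riesz_ge0.
pose F x := \int[@surf R]_(y in cell eps xi G) ((w x - w y) ^+ 2 * riesz al (x, y))%:E.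
pose F' x := \int[@surf R]_(y in G)
  (((w \o tau xi) x - (w \o tau xi) y) ^+ 2 * riesz al (x, y))%:E.
have F0 x : 0 <= F x by apply: integral_ge0 => y _; exact: incr0.
have F'0 x : 0 <= F' x by apply: integral_ge0 => y _; exact: incr0.
have mF : measurable_fun setT F := measurable_gagliardo_inner al mc cfin mw.
have mF' : measurable_fun setT F' := measurable_gagliardo_inner al mG Gfin mwt.
pose k := (eps `^ (- (2 + 2 * al)))%R.
have k0 : (0 <= k)%R := powR_ge0 _ _.
have inner x : F (tau xi x) = (eps ^+ 2 * k)%:E * F' x.
  apply: surf_integral_cell_scaled => //.
  - exact: (measurable_fun_pair2 (tau xi x) (measurable_increment (measurable_riesz al) mw)).
  - exact: (measurable_fun_pair2 x (measurable_increment (measurable_riesz al) mwt)).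
  - by move=> y; rewrite riesz_cell_map -EFinM mulrCA.
have k1 : (0 <= eps ^+ 2 * k)%R by rewrite mulr_ge0 ?sqr_ge0.
have outer := surf_integral_cell_scaled k1 mF mF' F0 F'0 inner.
transitivity ((eps `^ (2 * al))%:E * ((eps ^+ 2 * (eps ^+ 2 * k))%:E * \int[@surf R]_(x in G) F' x)).
  by congr (_ * _); exact: outer.
rewrite !muleA -!EFinM; congr (_%:E * _).
have -> : k = ((eps ^+ 2) * eps `^ (2 * al))^-1%R.
  rewrite /k powRN powRD; last by rewrite (gt_eqF eps0) implybT.
  by rewrite (powR_mulrn 2 (ltW eps0)).
have e2 : (eps ^+ 2 != 0)%R by rewrite expf_neq0 ?gt_eqF.
have ea : (eps `^ (2 * al) != 0)%R by rewrite gt_eqF ?powR_gt0.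
by field; rewrite ea gt_eqF.
Qed.

End cell_scaling.

(** * Fractional norms on the union of the cells *)

Section extension_spaces.
Context (R : realType).
Implicit Types (al : R) (G S Om : set (pt R)).

(** Functions on [S] normed through their extension by 0 to a larger surface [G].
    With [G = S] this is [H_space al S], and with [G = bd Sc] it is
    [Htilde_space al Sc S]; likewise on the union of the cells. *)
Definition ext_space al G S : seminormed R (pt R -> R) :=
  Seminormed [set v | H_space al S v /\ H_space al G (v \_ S)]
    (fun v => H_norm al G (v \_ S)).

Definition ext_eps_space al Om (eps : R) G S : seminormed R (pt R -> R) :=
  Seminormed
    [set v | Heps_space al Om eps S v /\
             Heps_space al Om eps G (v \_ (cell_union Om eps S))]
    (fun v => Heps_norm al Om eps G (v \_ (cell_union Om eps S))).

End extension_spaces.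

Section norms.
Local Open Scope ereal_scope.
Context (R : realType) (al : R).
Implicit Types (v w : pt R -> R).

Lemma L2sq_eq_on G v w : {in G, v =1 w} -> L2sq G v = L2sq G w.
Proof. by move=> vw; apply: eq_integral => x /vw ->. Qed.

Lemma gagliardo_eq_on G v w : {in G, v =1 w} -> gagliardo al G v = gagliardo al G w.
Proof.
move=> vw; apply: eq_integral => x /vw ->.
by apply: eq_integral => y /vw ->.
Qed.

Lemma H_norm_eq_on G v w : {in G, v =1 w} -> H_norm al G v = H_norm al G w.
Proof. by move=> vw; rewrite /H_norm (L2sq_eq_on vw) (gagliardo_eq_on vw). Qed.

Lemma patch_in (T : Type) (D : set T) (f : T -> R) : {in D, f \_ D =1 f}.
Proof. by move=> x xD; rewrite patchE xD. Qed.

Lemma poweR_half_sqr (x : \bar R) : 0 <= x -> (x `^ 2^-1) ^+ 2 = x.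
Proof.
case: x => [r| |] // r0; last by rewrite poweRyr ?invr_eq0// expe2 mulyy.
rewrite poweR_EFin -EFin_expe -powR_mulrn ?powR_ge0// -powRrM mulVf// powRr1//.
Qed.

Lemma poweR_half_le (x y : \bar R) : 0 <= x -> x <= y -> x `^ 2^-1 <= y `^ 2^-1.
Proof.
move=> x0 xy; apply: gt0_ler_poweR => //; rewrite in_itv/= leey andbT//.
exact: le_trans xy.
Qed.

Lemma poweR_half_lty (x : \bar R) : (x `^ 2^-1 < +oo) = (x < +oo).
Proof.
apply/idP/idP; first by apply: lty_poweRy; rewrite invr_eq0.
exact: poweR_lty.
Qed.

Section one_cell.
Context (G S : set (pt R)) (mG : measurable G) (Gfin : surf G < +oo)
  (mS : measurable S) (SG : S `<=` G).

Let Sfin : surf S < +oo.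
Proof. exact: le_lt_trans (le_surf SG) Gfin. Qed.

Lemma H_normE v : measurable_fun setT v ->
  H_norm al G v = energy (surf_on mG Gfin) (riesz al) v `^ 2^-1.
Proof. by move=> mv; rewrite /H_norm energy_surf_on. Qed.

Lemma energy_eq_on v w : measurable_fun setT v -> measurable_fun setT w ->
  {in G, v =1 w} ->
  energy (surf_on mG Gfin) (riesz al) v = energy (surf_on mG Gfin) (riesz al) w.
Proof.
move=> mv mw vw.
rewrite -(energy_surf_on al mG Gfin mv) -(energy_surf_on al mG Gfin mw).
by rewrite (L2sq_eq_on vw) (gagliardo_eq_on vw).
Qed.

(** The restriction to [S] of the extension has smaller energy, so finiteness on
    [G] is the only condition besides measurability. *)
Lemma ext_spaceP v : ext_space al G S v <->
  measurable_fun S v /\ energy (surf_on mG Gfin) (riesz al) (v \_ S) < +oo.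
Proof.
split=> [[[mv _] [_ fin]]|[mv fin]].
  by split => //; rewrite -poweR_half_lty -H_normE//; exact/(measurable_restrictT _ mS).
have mvS : measurable_fun setT (v \_ S) by exact/(measurable_restrictT _ mS).
split; split => //.
- rewrite -(H_norm_eq_on (@patch_in _ S v)) /H_norm (energy_surf_on al mS Sfin mvS).
  by rewrite poweR_half_lty; apply: le_lt_trans fin; exact: energy_surf_on_le.
- exact: measurable_funTS.
- by rewrite H_normE// poweR_half_lty.
Qed.

End one_cell.

Section all_cells.
Context (eps : R) (eps0 : (0 < eps)%R) (Om : set (pt R)) (s : seq (int * int * int)).
Hypothesis (us : uniq s) (sXi : Xi Om eps = [set` s]).
Local Notation tau := (cell_map eps).

Lemma cell_union_bigsetU G : G `<=` @unit_cube R ->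
  cell_union Om eps G = \big[setU/set0]_(xi <- s) cell eps xi G.
Proof. by move=> Gc; rewrite cell_unionE// sXi bigcup_seq. Qed.

Lemma measurable_cell_union G : measurable G -> G `<=` @unit_cube R ->
  measurable (cell_union Om eps G).
Proof.
move=> mG Gc; rewrite cell_union_bigsetU//; apply: bigsetU_measurable => xi _.
exact: measurable_cell.
Qed.

Lemma cell_union_cell_map G xi y : G `<=` @unit_cube R -> xi \in s ->
  unit_cube y -> cell_union Om eps G (tau xi y) <-> G y.
Proof.
move=> Gc xis cy; rewrite cell_unionE// sXi; split => [[xi' _ [y' Gy' e]]|Gy].
  have cy' := Gc _ Gy'.
  rewrite -(fpart_cell_map eps0 xi cy) -[tau xi y]e -/(tau xi' y').
  by rewrite fpart_cell_map.
by exists xi => //; exists y.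
Qed.

Section norm_formula.
Context (G : set (pt R)) (mG : measurable G) (Gfin : surf G < +oo)
  (Gc : G `<=` @unit_cube R).

Lemma L2sq_cell_union w : measurable_fun setT w ->
  L2sq (cell_union Om eps G) w =
  \sum_(xi <- s) (eps ^+ 2)%:E * L2sq G (w \o tau xi).
Proof.
move=> mw; rewrite /L2sq cell_union_bigsetU//.
rewrite ge0_integral_bigsetU//.
- by apply: eq_bigr => xi _; rewrite -[LHS]/(L2sq _ w) L2sq_cell.
- by move=> xi; exact: measurable_cell.
- exact: trivIset_cell.
- by apply: measurable_funTS; exact: measurable_sqr.
- by move=> x _; rewrite lee_fin sqr_ge0.
Qed.

(** The norm on the union of the cells is determined by the slices [w \o tau xi],
    which live on the fixed surface [G]. *)
Lemma Heps_normE w : measurable_fun setT w ->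
  Heps_norm al Om eps G w =
  ((eps ^+ 2)%:E * \sum_(xi <- s) energy (surf_on mG Gfin) (riesz al) (w \o tau xi)) `^ 2^-1.
Proof.
move=> mw; rewrite /Heps_norm L2sq_cell_union// sXi.
have gag0 A v : 0 <= gagliardo al A v.
  rewrite gagliardoE; apply: integral_ge0 => x _; apply: integral_ge0 => y _.
  by rewrite lee_fin mulr_ge0 ?sqr_ge0 ?riesz_ge0.
have e0 : 0 <= (eps ^+ 2)%:E :> \bar R by rewrite lee_fin sqr_ge0.
rewrite esum_fset; [|exact: finite_seq|by move=> xi _; exact: gag0].
rewrite -fsbig_seq// ge0_sume_distrr//.
rewrite -big_split/=; congr (_ `^ _).
rewrite ge0_sume_distrr//; last by move=> xi _; apply: energy_ge0 => //; exact: riesz_ge0.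
apply: eq_bigr => xi _; rewrite gagliardo_cell//.
have mwt : measurable_fun setT (w \o tau xi).
  by apply: measurableT_comp => //; exact: measurable_cell_map.
have l20 : 0 <= L2sq G (w \o tau xi).
  by apply: integral_ge0 => x _; rewrite lee_fin sqr_ge0.
by rewrite -(energy_surf_on al mG Gfin mwt) (ge0_muleDr _ l20 (gag0 G _)).
Qed.

End norm_formula.

Section extension.
Context (G S : set (pt R)) (mG : measurable G) (Gfin : surf G < +oo)
  (Gc : G `<=` @unit_cube R) (mS : measurable S) (SG : S `<=` G).

Let Sfin : surf S < +oo.
Proof. exact: le_lt_trans (le_surf SG) Gfin. Qed.

Let Sc : S `<=` @unit_cube R. Proof. exact: subset_trans Gc. Qed.

Definition cell_energy (u : pt R -> R) xi : \bar R :=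
  energy (surf_on mG Gfin) (riesz al) ((u \o tau xi) \_ S).

Definition eps_energy (u : pt R -> R) : \bar R :=
  (eps ^+ 2)%:E * \sum_(xi <- s) cell_energy u xi.

Lemma cell_energy_ge0 u xi : 0 <= cell_energy u xi.
Proof. by apply: energy_ge0; exact: riesz_ge0. Qed.

Lemma eps_energy_ge0 u : 0 <= eps_energy u.
Proof.
rewrite mule_ge0// ?lee_fin ?sqr_ge0//.
by apply: sume_ge0 => xi _; exact: cell_energy_ge0.
Qed.

Lemma measurable_slice (u : pt R -> R) xi : xi \in s ->
  measurable_fun (cell_union Om eps S) u -> measurable_fun setT ((u \o tau xi) \_ S).
Proof.
move=> xis mu; apply/(measurable_restrictT _ mS).
apply: (measurable_comp (measurable_cell_union mS Sc) _ mu).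
  by move=> _ [y Sy <-]; apply/cell_union_cell_map => //; exact: Sc.
by apply: measurable_funTS; exact: measurable_cell_map.
Qed.

Lemma ext_slice (u : pt R -> R) xi : xi \in s ->
  {in G, (u \_ (cell_union Om eps S)) \o tau xi =1 (u \o tau xi) \_ S}.
Proof.
move=> xis y /set_mem Gy; rewrite /= !patchE.
have h := @cell_union_cell_map S xi y Sc xis (Gc Gy).
by case: ifPn => [/set_mem/h/mem_set ->|/negP h']//; case: ifPn => // /set_mem/h/mem_set/h'.
Qed.

Lemma ext_eps_normE u : measurable_fun (cell_union Om eps S) u ->
  Heps_norm al Om eps G (u \_ (cell_union Om eps S)) = eps_energy u `^ 2^-1.
Proof.
move=> mu.
have muS : measurable_fun setT (u \_ (cell_union Om eps S)).
  exact/(measurable_restrictT _ (measurable_cell_union mS Sc)).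
have slices xi : xi \in s -> energy (surf_on mG Gfin) (riesz al)
    ((u \_ (cell_union Om eps S)) \o tau xi) = cell_energy u xi.
  move=> xis; apply: (energy_eq_on mG Gfin _ (measurable_slice xis mu)); last exact: ext_slice.
  by apply: measurableT_comp => //; exact: measurable_cell_map.
rewrite (Heps_normE mG Gfin Gc muS) /eps_energy.
exact: (congr1 (fun t => ((eps ^+ 2)%:E * t) `^ 2^-1) (eq_big_seq _ slices)).
Qed.

End extension.

End all_cells.

End norms.

Section uniform_cube.
Local Open Scope ereal_scope.
Context (R : realType).

(** Volume on the unit cube, as a probability on the whole space. *)
Definition uniform_cube : set (pt R) -> \bar R := mrestr (leb3 R) (@measurable_unit_cube R).

HB.instance Definition _ := Measure.on uniform_cube.

Let uniform_cube_setT : uniform_cube setT = 1.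
Proof. by rewrite /uniform_cube /mrestr setTI leb3_unit_cube. Qed.

HB.instance Definition _ := Measure_isProbability.Build _ _ _ uniform_cube uniform_cube_setT.

Lemma ge0_integral_uniform_cube (f : pt R -> \bar R) : measurable_fun setT f ->
  (forall x, 0 <= f x) ->
  \int[uniform_cube]_x f x = \int[leb3 R]_(x in @unit_cube R) f x.
Proof. exact: ge0_integral_mrestr. Qed.

Lemma integral_uniform_cube (f : pt R -> \bar R) : measurable_fun setT f ->
  \int[uniform_cube]_x f x = \int[leb3 R]_(x in @unit_cube R) f x.
Proof.
move=> mf; rewrite integralE [RHS]integralE.
rewrite (ge0_integral_uniform_cube (measurable_funepos mf) (funepos_ge0 f)).
by rewrite (ge0_integral_uniform_cube (measurable_funeneg mf) (funeneg_ge0 f)).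
Qed.

End uniform_cube.

Section eps_space.
Local Open Scope ereal_scope.
Context (R : realType) (al eps : R) (eps0 : (0 < eps)%R).
Context (Om : set (pt R)) (s : seq (int * int * int)).
Hypothesis (us : uniq s) (sXi : Xi Om eps = [set` s]).
Context (G S : set (pt R)) (mG : measurable G) (Gfin : surf G < +oo)
  (Gc : G `<=` @unit_cube R) (mS : measurable S) (SG : S `<=` G).
Local Notation cuS := (cell_union Om eps S).
Local Notation Veps := (ext_eps_space al Om eps G S).
Local Notation Eeps := (eps_energy al eps s S mG Gfin).

Let Sfin : surf S < +oo.
Proof. exact: le_lt_trans (le_surf SG) Gfin. Qed.

Let Sc : S `<=` @unit_cube R. Proof. exact: subset_trans Gc. Qed.

Lemma Heps_norm_eq_on v w : {in cuS, v =1 w} ->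
  Heps_norm al Om eps S v = Heps_norm al Om eps S w.
Proof.
move=> vw.
have gvw xi : Xi Om eps xi -> gagliardo al (cell eps xi S) v = gagliardo al (cell eps xi S) w.
  move=> Xxi; apply: gagliardo_eq_on => x /set_mem cx.
  by apply: vw; apply/mem_set; rewrite cell_unionE//; exists xi.
rewrite /Heps_norm (L2sq_eq_on vw).
exact: (congr1 (fun t => (L2sq cuS w + (eps `^ (2 * al))%:E * t) `^ 2^-1) (eq_esum gvw)).
Qed.

Lemma ext_eps_spaceP u : Veps u <-> measurable_fun cuS u /\ Eeps u < +oo.
Proof.
have mcu := measurable_cell_union eps0 sXi mS Sc.
split=> [[[mu _] [_ fin]]|[mu fin]].
  split => //; move: fin.
  by rewrite (ext_eps_normE al eps0 us sXi mG Gfin Gc mS SG mu) poweR_half_lty.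
have muS : measurable_fun setT (u \_ cuS) by exact/(measurable_restrictT _ mcu).
split; split => //.
- rewrite -(Heps_norm_eq_on (@patch_in _ _ cuS u)).
  rewrite (ext_eps_normE al eps0 us sXi mS Sfin Sc mS (@subset_refl _ S) mu) poweR_half_lty.
  apply: le_lt_trans fin; apply: lee_wpmul2l; first by rewrite lee_fin sqr_ge0.
  rewrite !big_seq; apply: lee_sum => xi xis.
  apply: energy_surf_on_le => //; exact: (measurable_slice eps0 sXi Gc mS SG xis mu).
- exact: measurable_funTS.
- rewrite -[_ < _]/(Heps_norm al Om eps G (u \_ cuS) < +oo).
  by rewrite (ext_eps_normE al eps0 us sXi mG Gfin Gc mS SG mu) poweR_half_lty.
Qed.

Lemma ext_eps_seminormE u : Veps u -> seminorm Veps u = Eeps u `^ 2^-1.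
Proof.
move=> /ext_eps_spaceP[mu _].
exact: (ext_eps_normE al eps0 us sXi mG Gfin Gc mS SG mu).
Qed.

End eps_space.

(** * Energy of an averaged function *)

Section averaging.
Local Open Scope ereal_scope.
Context (R : realType) (al eps : R) (eps0 : (0 < eps)%R).
Context (Om : set (pt R)) (mOm : measurable Om) (s : seq (int * int * int)).
Hypothesis (us : uniq s) (sXi : Xi Om eps = [set` s]).
Context (G S : set (pt R)) (mG : measurable G) (Gfin : surf G < +oo)
  (Gc : G `<=` @unit_cube R) (mS : measurable S) (SG : S `<=` G).
Local Notation tau := (cell_map eps).
Local Notation cuS := (cell_union Om eps S).
Local Notation Eeps := (eps_energy al eps s S mG Gfin).
Local Notation Ecell := (cell_energy al eps S mG Gfin).
Local Notation sigma := (surf_on mG Gfin).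

Let Sc : S `<=` @unit_cube R. Proof. exact: subset_trans Gc. Qed.

Lemma cell_sub_Om xi z : xi \in s -> unit_cube z -> Om (tau xi z).
Proof.
move=> xis cz; have : Xi Om eps xi by rewrite sXi.
by apply; exists z.
Qed.

(** Bochner functions are measurable on [Om `*` S] only; the extension by 0 is
    measurable on the whole product, where Tonelli's theorem is applied. *)
Definition zero_ext (Phi : pt R -> pt R -> R) : pt R * pt R -> R :=
  (fun p => Phi p.1 p.2) \_ (Om `*` S).

Section one_function.
Variable Phi : pt R -> pt R -> R.
Hypothesis mPhi : measurable_fun (Om `*` S) (fun p : pt R * pt R => Phi p.1 p.2).
Local Notation Phi0 := (zero_ext Phi).

Lemma measurable_zero_ext : measurable_fun setT Phi0.
Proof. exact/(measurable_restrictT _ (measurableX mOm mS)). Qed.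

Lemma zero_ext_in x y : Om x -> S y -> Phi0 (x, y) = Phi x y.
Proof. by move=> Ox Sy; rewrite /zero_ext patchE mem_set. Qed.

Lemma zero_ext_notin x y : ~ S y -> Phi0 (x, y) = 0%R.
Proof. by move=> nSy; rewrite /zero_ext patchE memNset// => -[]. Qed.

Lemma zero_ext_slice x : Om x -> (fun y => Phi0 (x, y)) = (Phi x) \_ S.
Proof.
move=> Ox; apply/funext => y; rewrite [RHS]patchE; case: ifPn => [/set_mem|/negP] yS.
  exact: zero_ext_in.
by rewrite zero_ext_notin// => /mem_set.
Qed.

Definition pointwise_energy x : \bar R :=
  energy sigma (riesz al) (fun y => Phi0 (x, y)).

Lemma pointwise_energy_ge0 x : 0 <= pointwise_energy x.
Proof. by apply: energy_ge0; exact: riesz_ge0. Qed.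

Lemma measurable_pointwise_energy : measurable_fun setT pointwise_energy.
Proof.
exact: (measurable_energy_slice sigma (measurable_riesz al) (@riesz_ge0 R al) measurable_zero_ext).
Qed.

Lemma seminorm_slice x : Om x ->
  seminorm (ext_space al G S) (Phi x) = pointwise_energy x `^ 2^-1.
Proof.
move=> Ox; have mx : measurable_fun setT ((Phi x) \_ S).
  rewrite -zero_ext_slice//; exact: (measurable_fun_pair2 x measurable_zero_ext).
by rewrite /= (H_normE al mG Gfin mx) /pointwise_energy (zero_ext_slice Ox).
Qed.

Lemma bochner_normE : bochner_norm Om (ext_space al G S) Phi =
  (\int[leb3 R]_(x in Om) pointwise_energy x) `^ 2^-1.
Proof.
rewrite /bochner_norm; congr (_ `^ _); apply: eq_integral => x /set_mem Ox.
by rewrite seminorm_slice// poweR_half_sqr// pointwise_energy_ge0.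
Qed.

Definition cell_ext xi (p : pt R * pt R) : R := Phi0 (tau xi p.1, p.2).

Lemma measurable_cell_ext xi : measurable_fun setT (cell_ext xi).
Proof.
apply: (measurableT_comp measurable_zero_ext); apply: measurable_fun_pair => //.
by apply: measurableT_comp => //; exact: measurable_cell_map.
Qed.

(** On the cell [xi], the averaging operator is the mean over [z] in the cube of
    the functions [y |-> Phi (tau xi z) y]. *)
Lemma Ub_slice xi : xi \in s ->
  (Ub eps Phi \o tau xi) \_ S = average (@uniform_cube R) (cell_ext xi).
Proof.
move=> xis; apply/funext => y; rewrite patchE /average /Rintegral.
have my : measurable_fun setT (fun z => (cell_ext xi (z, y))%:E).
  by apply/measurable_EFinP; exact: (measurable_fun_pair1 y (measurable_cell_ext xi)).
rewrite (integral_uniform_cube my); case: ifPn => [/set_mem yS|/negP yS].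
  rewrite /= /Ub /Rintegral; congr fine; apply: eq_integral => z /set_mem cz.
  have cy := Sc yS.
  rewrite (ipart_cell_map eps0 xi cy) (fpart_cell_map eps0 xi cy).
  by rewrite /cell_ext zero_ext_in//; exact: cell_sub_Om.
rewrite integral0_eq// => z _; rewrite /cell_ext zero_ext_notin// => /mem_set.
by move/yS.
Qed.

Lemma integral_cell_energy xi :
  \int[leb3 R]_(x in cell eps xi (@unit_cube R)) pointwise_energy x =
  (eps ^+ 3)%:E * \int[@uniform_cube R]_z energy sigma (riesz al) (fun y => cell_ext xi (z, y)).
Proof.
have mpe := measurable_pointwise_energy.
have mcomp : measurable_fun setT (pointwise_energy \o tau xi).
  by apply: measurableT_comp => //; exact: measurable_cell_map.
have h := leb3_integral_affine eps0 (@measurable_unit_cube R) (measurable_funTS mpe)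
  (fun x _ => pointwise_energy_ge0 x).
have h' := ge0_integral_uniform_cube mcomp (fun x => pointwise_energy_ge0 (tau xi x)).
exact: (etrans (h (eps *: zvec R xi)%R) (congr1 (fun t => (eps ^+ 3)%:E * t) (esym h'))).
Qed.

Hypothesis Phi_fin : \int[leb3 R]_(x in Om) pointwise_energy x < +oo.

Lemma cell_integral_lty xi : xi \in s ->
  \int[@uniform_cube R]_z energy sigma (riesz al) (fun y => cell_ext xi (z, y)) < +oo.
Proof.
move=> xis; set I := \int[_]_z _.
have e30 : (0 < eps ^+ 3)%R by rewrite exprn_gt0.
have : (eps ^+ 3)%:E * I < +oo.
  rewrite -integral_cell_energy; apply: le_lt_trans Phi_fin.
  apply: ge0_subset_integral => //.
  - by apply: measurable_cell => //; exact: measurable_unit_cube.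
  - by apply: measurable_funTS; exact: measurable_pointwise_energy.
  - by move=> x _; exact: pointwise_energy_ge0.
  - by move=> _ [z cz <-]; exact: cell_sub_Om.
move=> h; rewrite ltNge leye_eq; apply/negP => /eqP I_oo.
by move: h; rewrite I_oo mulry gtr0_sg// mul1e ltxx.
Qed.

Lemma cell_energy_Ub_le xi : xi \in s ->
  (eps ^+ 3)%:E * Ecell (Ub eps Phi) xi <=
  \int[leb3 R]_(x in cell eps xi (@unit_cube R)) pointwise_energy x.
Proof.
move=> xis; rewrite integral_cell_energy; apply: lee_wpmul2l.
  by rewrite lee_fin exprn_ge0// ltW.
rewrite /cell_energy (Ub_slice xis).
exact: (energy_average_le (measurable_riesz al) (@riesz_ge0 R al) (measurable_cell_ext xi)
  (cell_integral_lty xis)).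
Qed.

(** Jensen's inequality on each cell and the change of variables [x = tau xi z],
    of Jacobian [eps ^+ 3]; the cells are disjoint and contained in [Om]. *)
Lemma eps_energy_Ub_le : eps%:E * Eeps (Ub eps Phi) <=
  \int[leb3 R]_(x in Om) pointwise_energy x.
Proof.
have mcu xi : measurable (cell eps xi (@unit_cube R)).
  by apply: measurable_cell => //; exact: measurable_unit_cube.
have mU : measurable (\big[setU/set0]_(xi <- s) cell eps xi (@unit_cube R)).
  by apply: bigsetU_measurable => xi _; exact: mcu.
have UOm : \big[setU/set0]_(xi <- s) cell eps xi (@unit_cube R) `<=` Om.
  rewrite -bigcup_seq => _ [xi /= xis [z cz <-]]; exact: cell_sub_Om.
have mpe := measurable_pointwise_energy.
apply: (@le_trans _ _ (\int[leb3 R]_(x in \big[setU/set0]_(xi <- s) cell eps xi (@unit_cube R)) pointwise_energy x)); last first.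
  apply: ge0_subset_integral => //; first exact: measurable_funTS.
  by move=> x _; exact: pointwise_energy_ge0.
rewrite ge0_integral_bigsetU//; first last.
- by move=> x _; exact: pointwise_energy_ge0.
- exact: measurable_funTS.
- exact: trivIset_cell.
rewrite /eps_energy muleA -EFinM -exprS.
rewrite ge0_sume_distrr; last by move=> xi _; apply: energy_ge0; exact: riesz_ge0.
rewrite big_seq [leRHS]big_seq; apply: lee_sum => xi xis.
exact: cell_energy_Ub_le.
Qed.

(** [Ub eps Phi] is measurable on each of the finitely many pieces
    [cell eps xi S], being there a mean composed with the inverse of [tau xi]. *)
Lemma measurable_Ub : measurable_fun cuS (Ub eps Phi).
Proof.
have mcS xi : measurable (cell eps xi S) by exact: measurable_cell.
rewrite (cell_union_bigsetU eps0 sXi Sc).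
suff h t : {subset t <= s} ->
    measurable_fun (\big[setU/set0]_(xi <- t) cell eps xi S) (Ub eps Phi) by exact: h.
elim: t => [|xi t ih] ts; first by rewrite big_nil; exact: measurable_fun_set0.
have xis : xi \in s by rewrite ts// mem_head.
have {}ts : {subset t <= s} by move=> x xt; rewrite ts// inE xt orbT.
rewrite big_cons; apply/measurable_funU => //.
  by apply: bigsetU_measurable => xi' _.
split; last exact: ih.
have mw : measurable_fun setT (average (@uniform_cube R) (cell_ext xi)).
  exact: (measurable_average _ (measurable_cell_ext xi)).
have minv : measurable_fun setT (affine_inv (eps *: zvec R xi) eps).
  have -> : affine_inv (eps *: zvec R xi) eps = affine (- zvec R xi)%R eps^-1.
    apply/funext => x; rewrite /affine_inv /affine scalerBr scalerA mulVf ?gt_eqF//.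
    by rewrite scale1r addrC.
  exact: measurable_affine.
apply: (@eq_measurable_fun _ _ _ _ _ (average (@uniform_cube R) (cell_ext xi) \o affine_inv (eps *: zvec R xi) eps)).
  move=> _ /set_mem[y Sy <-]; have e : affine_inv (eps *: zvec R xi)%R eps (tau xi y) = y := affineK _ eps0 y.
  rewrite /= -[X in affine_inv _ _ X]/(tau xi y) e -[X in Ub _ _ X]/(tau xi y).
  by rewrite -(Ub_slice xis) patchE mem_set.
by apply: measurable_funTS; exact: measurableT_comp.
Qed.

Lemma ae_integrable_cell_ext xi : xi \in s ->
  {ae sigma, forall y, (@uniform_cube R).-integrable setT (fun z => (cell_ext xi (z, y))%:E)}.
Proof.
move=> xis.
exact: (ae_integrable_slice (measurable_riesz al) (@riesz_ge0 R al) (measurable_cell_ext xi)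
  (cell_integral_lty xis)).
Qed.

End one_function.

End averaging.

(** * Functionals and negligible sets *)

Section dual_facts.
Context (R : realType) (F : lmodType R) (V : seminormed R F) (phi : F -> R).
Hypothesis phiV : dual_space V phi.

Lemma dual_zero : V 0 -> phi 0 = 0.
Proof.
move=> V0; have := phiV.1 1 0 0 V0 V0; rewrite scaler0 addr0 mul1r; lra.
Qed.

Lemma dual_scale (a : R) (u : F) : V 0 -> V u -> phi (a *: u) = a * phi u.
Proof.
by move=> V0 Vu; have := phiV.1 a u 0 Vu V0; rewrite !addr0 dual_zero// addr0.
Qed.

Lemma dual_null (u : F) : V u -> (seminorm V u = 0)%E -> phi u = 0.
Proof.
move=> Vu u0; have [C /(_ u Vu)] := phiV.2.
by rewrite u0 mule0 lee_fin normr_le0 => /eqP.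
Qed.

Lemma dual_bound : exists2 C : R, 0 <= C &
  forall u, V u -> (0 <= seminorm V u)%E -> (`|phi u|%:E <= C%:E * seminorm V u)%E.
Proof.
have [C hC] := phiV.2; exists `|C| => // u Vu u0.
by apply: le_trans (hC u Vu) _; apply: lee_wpmul2r => //; rewrite lee_fin ler_norm.
Qed.

End dual_facts.

Section eps_dual.
Local Open Scope ereal_scope.
Context (R : realType) (al eps : R) (eps0 : (0 < eps)%R).
Context (Om : set (pt R)) (mOm : measurable Om) (s : seq (int * int * int)).
Hypothesis (us : uniq s) (sXi : Xi Om eps = [set` s]).
Context (G S : set (pt R)) (mG : measurable G) (Gfin : surf G < +oo)
  (Gc : G `<=` @unit_cube R) (mS : measurable S) (SG : S `<=` G).
Local Notation tau := (cell_map eps).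
Local Notation cuS := (cell_union Om eps S).
Local Notation V := (ext_space al G S).
Local Notation Veps := (ext_eps_space al Om eps G S).
Local Notation B := (L2_bochner Om S V).
Local Notation Eeps := (eps_energy al eps s S mG Gfin).
Local Notation Ecell := (cell_energy al eps S mG Gfin).
Local Notation sigma := (surf_on mG Gfin).

Implicit Types (u v : pt R -> R) (Phi Psi : pt R -> pt R -> R).

Let VepsP := ext_eps_spaceP al eps0 us sXi mG Gfin Gc mS SG.
Let mslice := fun u xi (xis : xi \in s) => @measurable_slice _ eps eps0 Om s sXi G S Gc mS SG u xi xis.
Let Veps_normE := @ext_eps_seminormE _ al eps eps0 Om s us sXi G S mG Gfin Gc mS SG.

Lemma energy0 : energy sigma (riesz al) (fun=> 0%R) = 0.
Proof.
have e1 : \int[sigma]_x (0 ^+ 2 : R)%:E = 0.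
  by apply: integral0_eq => x _; rewrite expr0n.
have e2 : \int[sigma]_x \int[sigma]_y ((0 - 0) ^+ 2 * riesz al (x, y))%:E = 0.
  apply: integral0_eq => x _; apply: integral0_eq => y _.
  by rewrite subrr expr0n mul0r.
by rewrite /energy e1 e2 adde0.
Qed.

Lemma eps_energyZ (a : R) u : measurable_fun cuS u ->
  Eeps (a *: u)%R = (a ^+ 2)%:E * Eeps u.
Proof.
move=> mu; rewrite /eps_energy muleCA; congr (_ * _).
rewrite ge0_sume_distrr; last by move=> xi _; exact: cell_energy_ge0.
apply: eq_big_seq => xi xis; rewrite /cell_energy.
have -> : ((a *: u)%R \o tau xi) \_ S = (fun y => a * ((u \o tau xi) \_ S) y)%R.
  by apply/funext => y; rewrite !patchE; case: ifPn => // _; rewrite mulr0.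
exact: (energyZ sigma (measurable_riesz al) (@riesz_ge0 R al) a (mslice xis mu)).
Qed.

Lemma Veps_scale (a : R) u : Veps u -> Veps (a *: u)%R.
Proof.
move=> /VepsP[mu fin]; apply/VepsP; split.
  by rewrite -[(a *: u)%R]/(fun x => a * u x)%R; exact: measurable_funM.
by rewrite eps_energyZ// lte_mul_pinfty// lee_fin sqr_ge0.
Qed.

Lemma Veps_normZ (a : R) u : Veps u -> seminorm Veps (a *: u)%R = `|a|%:E * seminorm Veps u.
Proof.
move=> Vu; rewrite (Veps_normE (Veps_scale a Vu)) (Veps_normE Vu).
have [mu _] := (VepsP u).1 Vu.
rewrite (eps_energyZ a mu) poweRM ?lee_fin ?sqr_ge0//; last exact: eps_energy_ge0.
by rewrite poweR_EFin powR12_sqrt ?sqr_ge0// sqrtr_sqr.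
Qed.

Lemma cell_energy_ae_eq u u' xi : xi \in s -> measurable_fun cuS u -> measurable_fun cuS u' ->
  {ae sigma, forall y, ((u \o tau xi) \_ S) y = ((u' \o tau xi) \_ S) y} ->
  Ecell u xi = Ecell u' xi.
Proof.
move=> xis mu mu' ae.
exact: (energy_ae_eq (measurable_riesz al) (@riesz_ge0 R al) (mslice xis mu) (mslice xis mu') ae).
Qed.

Lemma eps_energy_ae_eq u u' : measurable_fun cuS u -> measurable_fun cuS u' ->
  (forall xi, xi \in s -> {ae sigma, forall y, ((u \o tau xi) \_ S) y = ((u' \o tau xi) \_ S) y}) ->
  Eeps u = Eeps u'.
Proof.
move=> mu mu' ae.
have e xi : xi \in s -> Ecell u xi = Ecell u' xi.
  by move=> xis; apply: cell_energy_ae_eq => //; exact: ae.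
exact: (congr1 (fun t => (eps ^+ 2)%:E * t) (eq_big_seq _ e)).
Qed.

Lemma Veps0 : Veps (0 : pt R -> R)%R.
Proof.
apply/VepsP; split; first exact: measurable_cst.
rewrite /eps_energy big1 ?mule0// => xi _; rewrite /cell_energy.
rewrite (_ : _ \_ S = fun=> 0%R) ?energy0//.
by apply/funext => y; rewrite patchE; case: ifP.
Qed.

(** Functions which agree almost everywhere in each cell differ by a function of
    seminorm 0, on which a bounded functional vanishes. *)
Lemma dual_ae_eq phi u u' : dual_space Veps phi -> measurable_fun cuS u -> Veps u' ->
  (forall xi, xi \in s -> {ae sigma, forall y, ((u \o tau xi) \_ S) y = ((u' \o tau xi) \_ S) y}) ->
  Veps u /\ phi u = phi u'.
Proof.
move=> phiV mu Vu' ae; have [mu' fin'] := (VepsP u').1 Vu'.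
have Vu : Veps u.
  apply/VepsP; split; first exact: mu.
  by rewrite (eps_energy_ae_eq mu mu' ae); exact: fin'.
split => //.
have md : measurable_fun cuS (u - u')%R by exact: measurable_funB.
have m0 : measurable_fun cuS (0 : pt R -> R)%R by exact: measurable_cst.
have Ed : Eeps (u - u')%R = Eeps (0 : pt R -> R)%R.
  apply: eps_energy_ae_eq => // xi xis; apply: filterS (ae xi xis) => y.
  rewrite !patchE; case: ifPn => // _ /= e.
  by rewrite -[(u - u')%R _]/(u (tau xi y) - u' (tau xi y))%R e subrr.
have E0 : Eeps (0 : pt R -> R)%R = 0.
  have := eps_energyZ 0 m0; rewrite scaler0 => ->.
  by rewrite expr0n/= mul0e.
have Vd : Veps (u - u')%R.
  by apply/VepsP; split; [exact: md|rewrite Ed E0].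
have phid : phi (u - u')%R = 0%R.
  by apply: (dual_null phiV Vd); rewrite (Veps_normE Vd) Ed E0 poweR0r//.
have := phiV.1 1%R (u - u')%R u' Vd Vu'.
by rewrite scale1r subrK mul1r phid add0r.
Qed.

Lemma bochner_fin Phi : B Phi -> \int[leb3 R]_(x in Om) pointwise_energy al Om S mG Gfin Phi x < +oo.
Proof.
by move=> [mPhi _ _]; rewrite (bochner_normE al mOm mG Gfin mS mPhi) poweR_half_lty.
Qed.

Lemma Ub_Veps Phi : B Phi -> Veps (Ub eps Phi).
Proof.
move=> BPhi; have [mPhi _ _ _] := BPhi; have fin := bochner_fin BPhi.
apply/VepsP; split.
  exact: (measurable_Ub eps0 mOm sXi Gc mS SG mPhi).
have h := eps_energy_Ub_le eps0 mOm us sXi Gc mS SG mPhi fin.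
have := le_lt_trans h fin; rewrite ltNge leye_eq => /negP nE.
by rewrite ltNge leye_eq; apply/negP => /eqP e; apply: nE; rewrite e mulry gtr0_sg// mul1e.
Qed.

Lemma sqrt_eps_norm_Ub Phi : B Phi ->
  (Num.sqrt eps)%:E * seminorm Veps (Ub eps Phi) <= bochner_norm Om V Phi.
Proof.
move=> BPhi; have [mPhi _ _ _] := BPhi; have fin := bochner_fin BPhi.
rewrite (Veps_normE (Ub_Veps BPhi)).
rewrite (bochner_normE al mOm mG Gfin mS mPhi).
have E0 := eps_energy_ge0 al eps s S mG Gfin (Ub eps Phi).
have e0 : 0 <= eps%:E by rewrite lee_fin ltW.
rewrite -(powR12_sqrt (ltW eps0)) -poweR_EFin -(poweRM _ e0 E0).
apply: poweR_half_le; first exact: mule_ge0.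
exact: (eps_energy_Ub_le eps0 mOm us sXi Gc mS SG mPhi fin).
Qed.

End eps_dual.

(** * Upper bound for the norm of the unfolded functional *)

Section unfolding_dual.
Local Open Scope ereal_scope.
Context (R : realType) (al eps : R) (eps0 : (0 < eps)%R).
Context (Om : set (pt R)) (mOm : measurable Om) (s : seq (int * int * int)).
Hypothesis (us : uniq s) (sXi : Xi Om eps = [set` s]).
Context (G S : set (pt R)) (mG : measurable G) (Gfin : surf G < +oo)
  (Gc : G `<=` @unit_cube R) (mS : measurable S) (SG : S `<=` G).
Local Notation tau := (cell_map eps).
Local Notation cuS := (cell_union Om eps S).
Local Notation V := (ext_space al G S).
Local Notation Veps := (ext_eps_space al Om eps G S).
Local Notation B := (L2_bochner Om S V).
Local Notation sigma := (surf_on mG Gfin).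

Implicit Types (u v : pt R -> R) (Phi Psi : pt R -> pt R -> R).

Let VepsP := ext_eps_spaceP al eps0 us sXi mG Gfin Gc mS SG.

Lemma zero_ext_linear (a : R) Phi Psi p :
  zero_ext Om S (a *: Phi + Psi)%R p = (a * zero_ext Om S Phi p + zero_ext Om S Psi p)%R.
Proof. by rewrite /zero_ext !patchE; case: ifP => // _; rewrite mulr0 addr0. Qed.

Lemma measurable_linear (a : R) Phi Psi :
  measurable_fun (Om `*` S) (fun p : pt R * pt R => Phi p.1 p.2) ->
  measurable_fun (Om `*` S) (fun p : pt R * pt R => Psi p.1 p.2) ->
  measurable_fun (Om `*` S) (fun p : pt R * pt R => (a *: Phi + Psi)%R p.1 p.2).
Proof.
move=> mPhi mPsi.
by apply: (measurable_funD (f := fun p => a * Phi p.1 p.2)%R) => //; exact: measurable_funM.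
Qed.

(** [Ub] is linear only where the slices are integrable, that is almost
    everywhere on [S]. *)
Lemma Ub_linear_ae (a : R) Phi Psi xi : xi \in s -> B Phi -> B Psi ->
  {ae sigma, forall y,
     (((Ub eps (a *: Phi + Psi) - a *: Ub eps Phi)%R \o tau xi) \_ S) y =
     ((Ub eps Psi \o tau xi) \_ S) y}.
Proof.
move=> xis BPhi BPsi; have [mPhi _ _ _] := BPhi; have [mPsi _ _ _] := BPsi.
have fPhi := bochner_fin mOm mG Gfin mS BPhi.
have fPsi := bochner_fin mOm mG Gfin mS BPsi.
have mT := measurable_linear a mPhi mPsi.
have := ae_integrable_cell_ext eps0 mOm sXi mS mPsi fPsi xis.
have := ae_integrable_cell_ext eps0 mOm sXi mS mPhi fPhi xis.
apply: filterS2 => y iPhi iPsi.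
have e : ((Ub eps (a *: Phi + Psi)%R \o tau xi) \_ S) y =
    (a * ((Ub eps Phi \o tau xi) \_ S) y + ((Ub eps Psi \o tau xi) \_ S) y)%R.
  rewrite (Ub_slice eps0 mOm sXi Gc mS SG mPhi xis) (Ub_slice eps0 mOm sXi Gc mS SG mPsi xis).
  rewrite (Ub_slice eps0 mOm sXi Gc mS SG mT xis) /average.
  have iaPhi : (@uniform_cube R).-integrable setT
      (EFin \o (fun z => a * cell_ext eps Om S Phi xi (z, y))%R).
    have -> : EFin \o (fun z => a * cell_ext eps Om S Phi xi (z, y))%R =
        (fun z => a%:E * (cell_ext eps Om S Phi xi (z, y))%:E).
      by apply/funext => z; rewrite /= EFinM.
    exact: integrableZl.
  rewrite -(RintegralZl a measurableT iPhi) -(RintegralD measurableT iaPhi iPsi).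
  by apply: eq_Rintegral => z _; rewrite /cell_ext zero_ext_linear.
have -> : (((Ub eps (a *: Phi + Psi) - a *: Ub eps Phi)%R \o tau xi) \_ S) y =
    (((Ub eps (a *: Phi + Psi)%R \o tau xi) \_ S) y - a * ((Ub eps Phi \o tau xi) \_ S) y)%R.
  by rewrite !patchE; case: ifP => // _; rewrite mulr0 subr0.
by rewrite e addrAC subrr add0r.
Qed.

(** [Tb eps phi] is linear although [Ub] is linear only almost everywhere, because
    [phi] does not see negligible sets. *)
Lemma Tb_dual phi : dual_space Veps phi -> dual_space B (Tb eps phi).
Proof.
move=> phiV; split.
  move=> a Phi Psi BPhi BPsi; rewrite /Tb.
  have [mPhi _ _ _] := BPhi; have [mPsi _ _ _] := BPsi.
  have mT := measurable_linear a mPhi mPsi.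
  have VPhi := Ub_Veps eps0 mOm us sXi mG Gfin Gc mS SG BPhi.
  have VPsi := Ub_Veps eps0 mOm us sXi mG Gfin Gc mS SG BPsi.
  have [muPhi _] := (VepsP _).1 VPhi.
  have mw : measurable_fun cuS (Ub eps (a *: Phi + Psi) - a *: Ub eps Phi)%R.
    apply: (measurable_funB (f := Ub eps (a *: Phi + Psi)%R) (g := fun x => a * Ub eps Phi x)%R).
      exact: (measurable_Ub eps0 mOm sXi Gc mS SG mT).
    exact: measurable_funM.
  have [Vw phiw] := dual_ae_eq eps0 us sXi Gc mS SG phiV mw VPsi
    (fun xi xis => Ub_linear_ae a xis BPhi BPsi).
  have := phiV.1 a _ _ VPhi Vw; rewrite phiw addrC subrK => ->.
  by rewrite mulrDr mulrCA.
have [C C0 hC] := dual_bound phiV.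
exists (Num.sqrt eps * C)%R => Phi BPhi.
have VPhi := Ub_Veps eps0 mOm us sXi mG Gfin Gc mS SG BPhi.
have h := hC _ VPhi (poweR_ge0 _ _).
rewrite /Tb normrM gtr0_norm// EFinM.
apply: (@le_trans _ _ (eps%:E * (C%:E * seminorm Veps (Ub eps Phi)))).
  by apply: lee_wpmul2l; [rewrite lee_fin ltW|exact: h].
have hs := sqrt_eps_norm_Ub eps0 mOm us sXi mG Gfin Gc mS SG BPhi.
rewrite -{1}(sqr_sqrtr (ltW eps0)) expr2 EFinM -muleA [in leRHS]EFinM -[leRHS]muleA.
apply: lee_wpmul2l; first by rewrite lee_fin sqrtr_ge0.
rewrite muleCA; apply: lee_wpmul2l; first by rewrite lee_fin.
exact: hs.
Qed.

(** If [Phi] has norm at most 1 then so has [w := sqrt eps *: Ub Phi], and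
    [eps * phi (Ub Phi) = sqrt eps * phi w]. *)
Lemma Tb_norm_le phi : dual_space Veps phi ->
  dual_norm B (Tb eps phi) <= (Num.sqrt eps)%:E * dual_norm Veps phi.
Proof.
move=> phiV; apply: ge_ereal_sup => _ [Phi [BPhi Phi1] <-].
have VPhi := Ub_Veps eps0 mOm us sXi mG Gfin Gc mS SG BPhi.
have hs := sqrt_eps_norm_Ub eps0 mOm us sXi mG Gfin Gc mS SG BPhi.
have V0 := Veps0 al eps0 us sXi mG Gfin Gc mS SG.
pose w := (Num.sqrt eps *: Ub eps Phi)%R.
have Vw : Veps w := Veps_scale eps0 us sXi mG Gfin Gc mS SG (Num.sqrt eps) VPhi.
have w1 : seminorm Veps w <= 1.
  rewrite (Veps_normZ eps0 us sXi mG Gfin Gc mS SG (Num.sqrt eps) VPhi).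
  rewrite ger0_norm ?sqrtr_ge0//.
  exact: le_trans hs Phi1.
have -> : (`|Tb eps phi Phi|%:E = (Num.sqrt eps)%:E * `|phi w|%:E).
  rewrite (dual_scale phiV _ V0 VPhi) /Tb -EFinM; congr (_%:E).
  by rewrite !normrM mulrA (ger0_norm (sqrtr_ge0 _)) -expr2 sqr_sqrtr ?ltW// gtr0_norm.
apply: lee_wpmul2l; first by rewrite lee_fin sqrtr_ge0.
by apply: ereal_sup_ubound; exists w.
Qed.

End unfolding_dual.

(** * Lower bound: lifting by cellwise constant functions *)

Section cellwise_constant.
Local Open Scope ereal_scope.
Context (R : realType) (al eps : R) (eps0 : (0 < eps)%R).
Context (Om : set (pt R)) (mOm : measurable Om) (s : seq (int * int * int)).
Hypothesis (us : uniq s) (sXi : Xi Om eps = [set` s]).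
Context (G S : set (pt R)) (mG : measurable G) (Gfin : surf G < +oo)
  (Gc : G `<=` @unit_cube R) (mS : measurable S) (SG : S `<=` G).
Local Notation tau := (cell_map eps).
Local Notation cuS := (cell_union Om eps S).
Local Notation V := (ext_space al G S).
Local Notation Veps := (ext_eps_space al Om eps G S).
Local Notation B := (L2_bochner Om S V).
Local Notation Eeps := (eps_energy al eps s S mG Gfin).
Local Notation Ecell := (cell_energy al eps S mG Gfin).
Local Notation sigma := (surf_on mG Gfin).

Implicit Types (u v : pt R -> R) (Phi Psi : pt R -> pt R -> R).

Let VepsP := ext_eps_spaceP al eps0 us sXi mG Gfin Gc mS SG.
Let mslice := fun u xi (xis : xi \in s) => @measurable_slice _ eps eps0 Om s sXi G S Gc mS SG u xi xis.

Let Sc : S `<=` @unit_cube R. Proof. exact: subset_trans Gc. Qed.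

Local Notation Q xi := (cell eps xi (@unit_cube R)).

(** The lifting of [u] to [Om x S] which, for [x] in a cell, is the rescaled
    restriction of [u] to that cell, and which is 0 for [x] outside the cells. *)
Definition cell_const u (x y : pt R) : R :=
  (\sum_(xi <- s) \1_(Q xi) x * u (tau xi y))%R.

Lemma cell_const_in u xi x : xi \in s -> Q xi x -> cell_const u x = u \o tau xi.
Proof.
move=> xis Qx; apply/funext => y; rewrite /cell_const (bigD1_seq xi)//=.
rewrite indicE mem_set// mul1r big1 ?addr0// => xi' xi'xi.
rewrite indicE memNset ?mul0r// => Qx'; move/eqP: xi'xi; apply.
have [z cz zx] := Qx; have [z' cz' z'x] := Qx'.
by apply: (cell_map_inj2 eps0 cz' cz); rewrite -[LHS]/(_ + _)%R z'x -zx.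
Qed.

Lemma cell_const_out u x : (forall xi, xi \in s -> ~ Q xi x) -> cell_const u x = 0%R.
Proof.
move=> nQ; apply/funext => y; rewrite /cell_const big_seq big1// => xi xis.
by rewrite indicE memNset ?mul0r//; exact: nQ.
Qed.

Lemma measurable_cube_cell xi : measurable (Q xi).
Proof. by apply: measurable_cell => //; exact: measurable_unit_cube. Qed.

Section one_u.
Variable u : pt R -> R.
Hypothesis Vu : Veps u.

Let mu : measurable_fun cuS u. Proof. by have [] := (VepsP u).1 Vu. Qed.

Lemma measurable_slice_on xi : xi \in s -> measurable_fun S (u \o tau xi).
Proof. by move=> xis; apply/(measurable_restrictT _ mS); exact: mslice. Qed.

Lemma measurable_cell_const :
  measurable_fun (Om `*` S) (fun p : pt R * pt R => cell_const u p.1 p.2).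
Proof.
have -> : (fun p : pt R * pt R => cell_const u p.1 p.2) =
    (fun p => \sum_(xi <- s) (if xi \in s then \1_(Q xi) p.1 * u (tau xi p.2) else 0))%R.
  by apply/funext => p; apply: eq_big_seq => xi ->.
apply: measurable_sum => xi; have [xis|_] := boolP (xi \in s); last exact: measurable_cst.
apply: measurable_funM.
  have m1 : measurable_fun setT (\1_(Q xi) : pt R -> R) by apply: measurable_indic; exact: measurable_cube_cell.
  by apply: measurable_funTS; exact: (measurableT_comp m1 measurable_fst).
apply: (measurable_comp mS _ (measurable_slice_on xis)).
  by move=> _ [[x y] [/= _ Sy] <-].
exact: measurable_funTS.
Qed.

Lemma cell_energy_lty xi : xi \in s -> Ecell u xi < +oo.
Proof.
move=> xis; have [_ fin] := (VepsP u).1 Vu.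
have e20 : (0 < eps ^+ 2)%R by rewrite exprn_gt0.
have Ele : (eps ^+ 2)%:E * Ecell u xi <= Eeps u.
  apply: lee_wpmul2l; first by rewrite lee_fin ltW.
  rewrite (bigD1_seq xi)//= leeDl//; apply: sume_ge0 => xi' _.
  exact: cell_energy_ge0.
have := le_lt_trans Ele fin; rewrite ltNge leye_eq => /negP nE.
by rewrite ltNge leye_eq; apply/negP => /eqP e; apply: nE; rewrite e mulry gtr0_sg// mul1e.
Qed.

Lemma cell_const_V x : V (cell_const u x).
Proof.
have VP := ext_spaceP al mG Gfin mS SG.
have [[xi [xis Qx]]|/forallNP nQ] := pselect (exists xi, xi \in s /\ Q xi x).
  rewrite (cell_const_in u xis Qx); apply/VP; split; first exact: measurable_slice_on.
  exact: cell_energy_lty.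
rewrite cell_const_out; last by move=> xi xis Qx; apply: (nQ xi).
apply/VP; split; first exact: measurable_cst.
rewrite (_ : _ \_ S = fun=> 0%R) ?energy0//.
by apply/funext => y; rewrite patchE; case: ifP.
Qed.

Lemma pointwise_energy_cell_const x : Om x ->
  pointwise_energy al Om S mG Gfin (cell_const u) x =
  \sum_(xi <- s) (\1_(Q xi) x)%:E * Ecell u xi.
Proof.
move=> Ox; rewrite /pointwise_energy (zero_ext_slice S (cell_const u) Ox).
have [[xi [xis Qx]]|/forallNP nQ] := pselect (exists xi, xi \in s /\ Q xi x).
  rewrite (cell_const_in u xis Qx) (bigD1_seq xi)//= indicE mem_set// mul1e.
  rewrite big1 ?adde0// => xi' xi'xi.
  rewrite indicE memNset ?mul0e// => Qx'; move/eqP: xi'xi; apply.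
  have [z cz zx] := Qx; have [z' cz' z'x] := Qx'.
  by apply: (cell_map_inj2 eps0 cz' cz); rewrite -[LHS]/(_ + _)%R z'x -zx.
rewrite cell_const_out; last by move=> xi xis Qx; apply: (nQ xi).
rewrite (_ : _ \_ S = fun=> 0%R); last by apply/funext => y; rewrite patchE; case: ifP.
rewrite energy0 big_seq big1// => xi xis.
by rewrite indicE memNset ?mul0e// => Qx; apply: (nQ xi).
Qed.

Lemma leb3_cell xi : leb3 R (Q xi) = (eps ^+ 3)%:E.
Proof.
rewrite [leb3 R _](leb3_affine (eps *: zvec R xi)%R eps0 (measurable_cube_cell xi)).
by rewrite preimage_image_affine// leb3_unit_cube mule1.
Qed.

(** Equality in [eps_energy_Ub_le] for the lifting: a mean of equal functions loses
    no energy, and nothing is left outside the cells. *)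
Lemma integral_cell_const :
  \int[leb3 R]_(x in Om) pointwise_energy al Om S mG Gfin (cell_const u) x =
  eps%:E * Eeps u.
Proof.
have E0 xi : 0 <= Ecell u xi := cell_energy_ge0 al eps S mG Gfin u xi.
transitivity (\int[leb3 R]_(x in Om) \sum_(xi <- s) (\1_(Q xi) x)%:E * Ecell u xi).
  by apply: eq_integral => x /set_mem; exact: pointwise_energy_cell_const.
rewrite (ge0_integral_sum _ mOm); last 2 first.
- move=> xi; apply: emeasurable_funM => //; apply/measurable_EFinP.
  by apply: measurable_indic; exact: measurable_cube_cell.
- by move=> xi x _; rewrite mule_ge0// lee_fin.
rewrite /eps_energy muleA -EFinM -exprS ge0_sume_distrr//.
apply: eq_big_seq => xi xis.
rewrite ge0_integralZr//; last first.
  by apply/measurable_EFinP; apply: measurable_indic; exact: measurable_cube_cell.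
congr (_ * _); rewrite integral_indic//; last exact: measurable_cube_cell.
rewrite setIidl ?leb3_cell// => _ [z cz <-]; exact: (cell_sub_Om sXi xis cz).
Qed.

Lemma bochner_cell_const : bochner_norm Om V (cell_const u) = (eps%:E * Eeps u) `^ 2^-1.
Proof.
by rewrite (bochner_normE al mOm mG Gfin mS measurable_cell_const) integral_cell_const.
Qed.

(** The lifting is itself a simple function. *)
Lemma strongly_measurable_cell_const : strongly_measurable Om V (cell_const u).
Proof.
exists (fun=> cell_const u); split.
  move=> _; exists (size s), (fun i => Q (nth (0, 0, 0) s i)%R),
    (fun i => if nth (0, 0, 0)%R s i \in s then u \o tau (nth (0, 0, 0)%R s i) else 0%R).
  split.
  - by move=> i; exact: measurable_cube_cell.
  - move=> i; rewrite mem_nth//.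
    have VP := ext_spaceP al mG Gfin mS SG.
    have si : nth (0, 0, 0)%R s i \in s by rewrite mem_nth.
    by apply/VP; split; [exact: measurable_slice_on|exact: cell_energy_lty].
  - move=> x y; rewrite /cell_const (big_nth (0, 0, 0)%R) big_mkord.
    by apply: eq_bigr => i _; rewrite mem_nth.
apply: aeW => x Ox.
rewrite (_ : (fun n : nat => _) = fun=> 0); first exact: cvg_cst.
apply/funext => n.
rewrite (_ : (fun y => _) = fun=> 0%R); last by apply/funext => y; rewrite subrr.
rewrite /= (_ : _ \_ S = fun=> 0%R); last by apply/funext => y; rewrite patchE; case: ifP.
rewrite (H_normE al mG Gfin (measurable_cst _)) energy0 poweR0r//.
Qed.

Lemma cell_const_B : B (cell_const u).
Proof.
split.
- exact: measurable_cell_const.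
- by apply: aeW => x _; exact: cell_const_V.
- exact: strongly_measurable_cell_const.
- have [_ fin] := (VepsP u).1 Vu.
  rewrite bochner_cell_const poweR_half_lty.
  by apply: lte_mul_pinfty; rewrite ?lee_fin ?ltW.
Qed.

Lemma Ub_cell_const : {in cuS, Ub eps (cell_const u) =1 u}.
Proof.
move=> x /set_mem; rewrite (cell_unionE eps0 Om Sc) sXi => -[xi xis [y Sy <-]].
rewrite -[(_ + _)%R]/(tau xi y) /Ub.
have cy := Sc Sy.
rewrite (ipart_cell_map eps0 xi cy) (fpart_cell_map eps0 xi cy).
transitivity (\int[leb3 R]_(z in @unit_cube R) u (tau xi y))%R.
  apply: eq_Rintegral => z /set_mem cz.
  by rewrite (cell_const_in u xis)//; exists z.
rewrite Rintegral_cst; last exact: measurable_unit_cube.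
by rewrite leb3_unit_cube mulr1.
Qed.

End one_u.

(** Given [u] in the unit ball, test [Tb eps phi] on the lifting of
    [(sqrt eps)^-1 *: u], which has norm equal to that of [u]. *)
Lemma Tb_norm_ge phi : dual_space Veps phi ->
  (Num.sqrt eps)%:E * dual_norm Veps phi <= dual_norm B (Tb eps phi).
Proof.
move=> phiV.
have sq0 : (0 < Num.sqrt eps)%R by rewrite sqrtr_gt0.
rewrite -lee_pdivlMl//; apply: ge_ereal_sup => _ [u [Vu u1] <-].
rewrite lee_pdivlMl//.
pose u' := ((Num.sqrt eps)^-1 *: u)%R.
have V0 := Veps0 al eps0 us sXi mG Gfin Gc mS SG.
have Vu' : Veps u' := Veps_scale eps0 us sXi mG Gfin Gc mS SG _ Vu.
have BPhi := cell_const_B Vu'.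
have [mu _] := (VepsP u).1 Vu.
have mUb := (VepsP _).1 (Ub_Veps eps0 mOm us sXi mG Gfin Gc mS SG BPhi).
have slices xi : xi \in s ->
    {ae sigma, forall y, ((Ub eps (cell_const u') \o tau xi) \_ S) y = ((u' \o tau xi) \_ S) y}.
  move=> xis; apply: aeW => y; rewrite !patchE; case: ifPn => // /set_mem Sy /=.
  apply: (Ub_cell_const u'); apply/mem_set.
  by apply/(cell_union_cell_map eps0 sXi Sc xis (Sc Sy)).
have [_ phiUb] := dual_ae_eq eps0 us sXi Gc mS SG phiV mUb.1 Vu' slices.
have -> : (Num.sqrt eps)%:E * `|phi u|%:E = `|Tb eps phi (cell_const u')|%:E.
  rewrite /Tb phiUb (dual_scale phiV _ V0 Vu) -EFinM; congr (_%:E).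
  rewrite !normrM normfV (gtr0_norm eps0) (gtr0_norm sq0) mulrA; congr (_ * _)%R.
  by rewrite -{2}(sqr_sqrtr (ltW eps0)) expr2 mulfK// gt_eqF.
apply: ereal_sup_ubound; exists (cell_const u') => //; split => //.
rewrite -[seminorm _ _]/(bochner_norm Om V (cell_const u')) (bochner_cell_const Vu').
rewrite (eps_energyZ al eps0 sXi mG Gfin Gc mS SG _ mu) exprVn (sqr_sqrtr (ltW eps0)) muleA -EFinM.
rewrite mulfV ?gt_eqF// mul1e.
by rewrite -(ext_eps_seminormE eps0 us sXi mG Gfin Gc mS SG Vu).
Qed.

Lemma Tb_dual_norm phi : dual_space Veps phi ->
  dual_norm B (Tb eps phi) = (Num.sqrt eps)%:E * dual_norm Veps phi.
Proof.
move=> phiV; apply/eqP; rewrite eq_le; apply/andP; split; last exact: Tb_norm_ge.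
exact: (Tb_norm_le eps0 mOm us sXi mG Gfin Gc mS SG phiV).
Qed.

End cellwise_constant.

(** * The two families of spaces *)

Lemma seminormed_ext (R : realType) (F : Type) (V W : seminormed R F) :
  (forall v, V v <-> W v) -> (forall v, seminorm V v = seminorm W v) -> V = W.
Proof.
case: V W => [C N] [C' N'] /= eC eN; congr Seminormed; last exact/funext.
by apply/funext => v; exact/propext/eC.
Qed.

Lemma ext_space_id (R : realType) (al : R) (S : set (pt R)) :
  ext_space al S S = H_space al S.
Proof.
have e v : H_norm al S (v \_ S) = H_norm al S v by apply: H_norm_eq_on; exact: patch_in.
have m v : measurable_fun S v -> measurable_fun S (v \_ S).
  move=> mv; apply: (eq_measurable_fun v) => // x xS; rewrite patchE xS//.
apply: seminormed_ext => v; last exact: e.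
split=> [[Hv _]|[mv fin]]; first exact: Hv.
split; split; [exact: mv|exact: fin|exact: m|].
by rewrite /= e; exact: fin.
Qed.

Lemma ext_eps_space_id (R : realType) (al eps : R) (Om S : set (pt R)) :
  0 < eps -> S `<=` @unit_cube R ->
  ext_eps_space al Om eps S S = Heps_space al Om eps S.
Proof.
move=> eps0 Sc.
have e v : Heps_norm al Om eps S (v \_ (cell_union Om eps S)) = Heps_norm al Om eps S v.
  by apply: (Heps_norm_eq_on al eps0 Sc (@subset_refl _ S)); exact: patch_in.
have m v : measurable_fun (cell_union Om eps S) v ->
    measurable_fun (cell_union Om eps S) (v \_ (cell_union Om eps S)).
  by move=> mv; apply: (eq_measurable_fun v) => // x xS; rewrite patchE xS.
apply: seminormed_ext => v; last exact: e.
split=> [[Hv _]|[mv fin]]; first exact: Hv.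
split; split; [exact: mv|exact: fin|exact: m|].
by rewrite /= e; exact: fin.
Qed.

Unset Implicit Arguments.

Theorem lemma4p1 (R : realType) (Om Sc S : set (pt R))
  (Om_domain : is_domain Om) (Om_bounded : bounded_set Om)
  (Om_lipschitz : lipschitz_boundary Om)
  (Sc_domain : is_domain Sc) (Sc_Y : closure Sc `<=` @unit_cube R)
  (Sc_C11 : C11_boundary Sc)
  (S_patch : exists U : set (pt R),
     [/\ open U, connected (U `&` bd Sc) & S = closure (U `&` bd Sc)])
  (eps : R) (eps_gt0 : 0 < eps) (al : R) (al01 : 0 < al < 1) :
  (forall phi : (pt R -> R) -> R,
     dual_space (Heps_space al Om eps S) phi ->
     dual_space (L2_bochner Om S (H_space al S)) (Tb eps phi) /\
     dual_norm (L2_bochner Om S (H_space al S)) (Tb eps phi) =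
       ((Num.sqrt eps)%:E * dual_norm (Heps_space al Om eps S) phi)%E) /\
  (forall phi : (pt R -> R) -> R,
     dual_space (Htilde_eps_space al Om eps Sc S) phi ->
     dual_space (L2_bochner Om S (Htilde_space al Sc S)) (Tb eps phi) /\
     dual_norm (L2_bochner Om S (Htilde_space al Sc S)) (Tb eps phi) =
       ((Num.sqrt eps)%:E *
        dual_norm (Htilde_eps_space al Om eps Sc S) phi)%E).
Proof.
have mOm : measurable Om by case: Om_domain => _ oOm _; exact: open_measurable3.
have bd_cube : bd Sc `<=` @unit_cube R by move=> x [cx _]; exact: Sc_Y.
have cbd : closed (bd Sc) by exact: bd_closed.
have mbd : measurable (bd Sc) by exact: closed_measurable3.
have bdfin : (surf (bd Sc) < +oo)%E.
  by apply: surf_boundary_lty => //; exact: compact_in_unit_cube.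
have [U [_ _ SE]] := S_patch.
have Sbd : S `<=` bd Sc.
  by rewrite SE => x cx; apply: cbd; apply: closure_subset cx => y [].
have mS : measurable S by rewrite SE; apply: closed_measurable3; exact: closed_closure.
have Sfin : (surf S < +oo)%E by exact: le_lt_trans (le_surf Sbd) bdfin.
have S_cube : S `<=` @unit_cube R by exact: subset_trans bd_cube.
have [s0 Xi_s0] : exists s : seq (int * int * int), Xi Om eps = [set` s].
  exact/finite_seqP/finite_Xi.
pose s := undup s0.
have us : uniq s := undup_uniq s0.
have Xi_s : Xi Om eps = [set` s].
  by rewrite Xi_s0; apply/seteqP; split => xi /=; rewrite mem_undup.
split=> phi.
- rewrite -(ext_eps_space_id al Om eps_gt0 S_cube) -(ext_space_id al S) => phiV.
  split; first exact: (Tb_dual eps_gt0 mOm us Xi_s mS Sfin S_cube mS (@subset_refl _ S) phiV).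
  exact: (Tb_dual_norm eps_gt0 mOm us Xi_s mS Sfin S_cube mS (@subset_refl _ S) phiV).
- move=> phiV.
  split; first exact: (Tb_dual eps_gt0 mOm us Xi_s mbd bdfin bd_cube mS Sbd phiV).
  exact: (Tb_dual_norm eps_gt0 mOm us Xi_s mbd bdfin bd_cube mS Sbd phiV).
Qed.
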